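(* Let $G$ be a connected finite graph and let $\vec r=(\ell_1,\dots,\ell_r)$ be a non-trivial color vector (with respect to $G$) with at least three colors, i.e. $r\ge 3$. Then the grouped Stirling complex $S_{\vec r}(G)$ is path-connected.
   Context: A graph $G$ is viewed as a topological space, with (finite) vertex set $V(G)$ and (finite) set $E(G)$ of closed edges (edges including their endpoints); $n=|V(G)|$. The interior of an edge is the edge without its endpoints. A color vector is a vector $\vec r=(\ell_1,\dots,\ell_r)$ of positive integers; the integers $1,\dots,r$ are called colors. It is non-trivial (with respect to $G$) if $\ell_1+\cdots+\ell_r>n$ and $\ell_i<n$ for each $i=1,\dots,r$. The grouped Stirling complex $S_{\vec r}(G)$ is the set of all $r$-tuples (configurations) $A=(A_1,\dots,A_r)$ such that: (a) $A_i\subset G$ and $|A_i|=\ell_i$ for $i=1,\dots,r$; (b) for each $v\in V(G)$ there is some $i$ with $v\in A_i$; (c) for each $i$, if $A_i$ contains a point $p$ in the interior of some $e\in E(G)$, then $A_i$ contains neither endpoint of $e$ and contains no point other than $p$ in the interior of any edge sharing an endpoint with $e$ (including $e$ itself). Topology: the set of $\ell$-element subsets of $G$ carries the quotient topology from the space of ordered $\ell$-tuples of distinct points of $G$ (a subspace of $G^\ell$), and $S_{\vec r}(G)$ has the subspace topology from the product over $i$ of the spaces of $\ell_i$-element subsets of $G$. *)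

(* Defs.v *)
From HB Require Import structures.
From mathcomp Require Import all_boot all_order all_algebra generic_quotient.
From mathcomp Require Import all_classical all_reals all_analysis.
Set Implicit Arguments.
Unset Strict Implicit.
Unset Printing Implicit Defensive.
Import Order.TTheory GRing.Theory Num.Theory.
Import numFieldNormedType.Exports.
Local Open Scope classical_set_scope.
Local Open Scope ring_scope.
Local Open Scope quotient_scope.
Local Open Scope card_scope.

(* Finite graphs; loops and parallel edges are allowed. The orientation given
   by [src] and [tgt] only serves to parametrize the edges by [0, 1]. *)
Record fin_graph := FinGraph {
  vertex : finType;
  edge : finType;
  src : edge -> vertex;
  tgt : edge -> vertex }.

Definition share_endpoint (G : fin_graph) (e f : edge G) : Prop :=
  exists v : vertex G,
    (v = src e \/ v = tgt e) /\ (v = src f \/ v = tgt f).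

Section Realization.
Variables (R : realType) (G : fin_graph).

(* The topological space of the graph is the quotient of the disjoint union of
   one point per vertex and one copy of [0, 1] per edge, in which the ends 0
   and 1 of the copy for [e] are identified with [src e] and [tgt e]. *)
Definition cell (c : vertex G + edge G) : set R :=
  if c is inr _ then `[0, 1] else [set 0].

Definition cells : Type := {c : vertex G + edge G & cell c}.

HB.instance Definition _ := Topological.on cells.

Lemma cell_vertex_subproof (v : vertex G) : (0 : R) \in cell (inl v).
Proof. by rewrite inE. Qed.

Definition vertex_cell (v : vertex G) : cells :=
  existT (fun c => set_type (cell c)) (inl v)
    (SigSub (cell_vertex_subproof v)).

Definition edge_cell (e : edge G) (t : `[0, 1]%classic : set R) : cells :=
  existT (fun c => set_type (cell c)) (inr e) t.

(* Two elements of [cells] are identified iff they have the same image. *)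
Definition attach (x : cells) : vertex G + edge G * R :=
  match x with
  | existT (inl v) _ => inl v
  | existT (inr e) t =>
      if val t == 0 then inl (src e)
      else if val t == 1 then inl (tgt e)
      else inr (e, val t)
  end.

Definition attach_rel : rel cells := fun x y => attach x == attach y.

Lemma attach_rel_refl : reflexive attach_rel.
Proof. by move=> x; exact: eqxx. Qed.

Lemma attach_rel_sym : symmetric attach_rel.
Proof. by move=> x y; exact: eq_sym. Qed.

Lemma attach_rel_trans : transitive attach_rel.
Proof. by move=> y x z /eqP xy /eqP yz; rewrite /attach_rel xy yz. Qed.

Definition attach_equiv :=
  EquivRel attach_rel attach_rel_refl attach_rel_sym attach_rel_trans.

Definition graph_space : Type := {eq_quot attach_equiv}.

HB.instance Definition _ :=
  Topological.copy graph_space (quotient_topology {eq_quot attach_equiv}).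
HB.instance Definition _ := Quotient.on graph_space.

Definition vertex_pt (v : vertex G) : graph_space :=
  \pi_graph_space (vertex_cell v).

Definition edge_pt (e : edge G) (t : `[0, 1]%classic : set R) : graph_space :=
  \pi_graph_space (edge_cell e t).

Definition edge_interior (e : edge G) : set graph_space :=
  [set edge_pt e t | t in [set t | 0 < val t < 1]].

End Realization.

(* Sets of exactly [l] points of [X], with the quotient topology from the
   space of ordered [l]-tuples of distinct points of [X]. *)
Section UnorderedConfigurations.
Variables (X : topologicalType) (l : nat).

Definition ordered_conf : Type :=
  [set f : {ptws 'I_l -> X} | injective f].

HB.instance Definition _ := Topological.on ordered_conf.

Definition subset_conf : Type := [set A : set X | A #= `I_l].

Lemma ordered_conf_card (f : ordered_conf) :
  range (val f : 'I_l -> X) \in [set A : set X | A #= `I_l].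
Proof.
have /set_mem /= fI := valP f.
rewrite inE /=; apply: (@card_eq_trans _ _ _ _ [set: 'I_l]).
  by apply: inj_card_eq => x y _ _; exact: fI.
by rewrite card_eq_sym; exact: card_II.
Qed.

Definition conf_range (f : ordered_conf) : subset_conf :=
  SigSub (ordered_conf_card f).

Lemma conf_range_surj (A : subset_conf) : exists f, conf_range f = A.
Proof.
have /set_mem /= cA := valP A.
have : [set: 'I_l] #= val A.
  by rewrite card_eq_sym; apply: card_eq_trans cA _; exact: card_II.
move=> /card_bijP[f [g fK gK]].
pose h (i : 'I_l) : X := val (f (to_setT i)).
have h_inj : h \in [set h : {ptws 'I_l -> X} | injective h].
  rewrite inE /= => i j /val_inj /(can_inj fK) ij.
  exact: (congr1 val ij).
exists (SigSub h_inj); apply: val_inj; apply/seteqP; split => x /=.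
  by move=> [i _ <-]; exact: set_valP.
move=> Ax; exists (val (g (SigSub (mem_set Ax)))) => //.
rewrite /h; set y := g _.
have -> : to_setT (val y) = y by exact: val_inj.
by rewrite gK.
Qed.

Definition conf_enum (A : subset_conf) : ordered_conf :=
  projT1 (cid (conf_range_surj A)).

Lemma conf_enumK : cancel conf_enum conf_range.
Proof. by move=> A; exact: (projT2 (cid (conf_range_surj A))). Qed.

HB.instance Definition _ :=
  isQuotient.Build ordered_conf subset_conf conf_enumK.
HB.instance Definition _ :=
  Topological.copy subset_conf (quotient_topology subset_conf).

End UnorderedConfigurations.

Definition points (X : topologicalType) (l : nat) (A : subset_conf X l) :
  set X := val A.

Definition color_vector (r : nat) (l : 'I_r -> nat) : Prop :=
  forall i, (0 < l i)%N.

Definition nontrivial (G : fin_graph) (r : nat) (l : 'I_r -> nat) : Prop :=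
  (#|vertex G| < \sum_(i < r) l i)%N /\ forall i, (l i < #|vertex G|)%N.

Definition configuration (R : realType) (G : fin_graph) (r : nat)
    (l : 'I_r -> nat) : Type :=
  prod_topology (fun i : 'I_r => subset_conf (graph_space R G) (l i)).

HB.instance Definition _ (R : realType) (G : fin_graph) (r : nat)
    (l : 'I_r -> nat) := Topological.on (configuration R G l).

Definition stirling_complex (R : realType) (G : fin_graph) (r : nat)
    (l : 'I_r -> nat) : set (configuration R G l) :=
  [set A |
    (forall v : vertex G, exists i, points (A i) (vertex_pt R v)) /\
    (forall i (e : edge G) p, points (A i) p -> edge_interior e p ->
      [/\ ~ points (A i) (vertex_pt R (src e)),
          ~ points (A i) (vertex_pt R (tgt e)) &
          forall (f : edge G) q, share_endpoint e f ->
            points (A i) q -> edge_interior f q -> q = p])].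
Arguments stirling_complex R G {r} l.

(* As usual, path-connected spaces are non-empty. *)
Definition path_connected (R : realType) (T : topologicalType) : Prop :=
  inhabited T /\
  forall x y : T, exists g : R -> T,
    [/\ {within `[0, 1], continuous g}, g 0 = x & g 1 = y].

(* Main.v *)
(* A point in the interior of an edge can be pushed to an end of that edge, so
   every configuration is joined to one lying on the vertices, i.e. to a
   placement of colours on the vertices leaving no vertex empty. An elementary
   move slides one colour along an edge to an end lacking it, provided that no
   vertex gets empty; it remains to connect all such placements by moves.
   As there are more colour tokens than vertices, some vertex is crowded.
   The key fact is that the contents of the two ends u, w of an edge can be
   interchanged. This is direct if u or w is crowded. If u and w carry the single
   colours a <> b, a third colour k, sitting on a crowded vertex next to u, can be
   parked on u while a and b trade places; to bring k there, first walk the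
   crowding to k, then carry k back, all of this outside {u, w} so that it
   can be undone after the interchange. If {u, w} separates the crowded vertices
   from the colours other than a and b, first push the crowding across
   {u, w} and use interchanges along another edge.
   Since G is connected, the contents of any two vertices can then be
   interchanged, hence colours move between arbitrary vertices, and the number
   of tokens misplaced with respect to a target placement can be decreased. *)

Require Import Defs.
From mathcomp Require Import all_boot all_order all_algebra generic_quotient.
From mathcomp Require Import all_classical all_reals all_analysis.
From mathcomp Require Import ring lra.
Set Implicit Arguments.
Unset Strict Implicit.
Unset Printing Implicit Defensive.
Import Order.TTheory GRing.Theory Num.Theory.
Import numFieldNormedType.Exports.

(** * Colourings of the vertices of a finite graph *)

Definition transp (V : eqType) (v w x : V) :=
  if x == v then w else if x == w then v else x.

Lemma transpK (V : eqType) (v w : V) : involutive (transp v w).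
Proof.
move=> x; rewrite /transp; case: (eqVneq x v) => [->|xv].
  by case: (eqVneq w v) => [->|_]; rewrite ?eqxx.
by case: (eqVneq x w) => [->|xw]; rewrite ?eqxx // (negPf xv) (negPf xw).
Qed.

Lemma transpC (V : eqType) (v w : V) : transp v w =1 transp w v.
Proof.
move=> x; rewrite /transp.
by case: (eqVneq x v) => [->|_] //; case: (eqVneq v w) => [->|].
Qed.

Lemma transpL (V : eqType) (v w : V) : transp v w v = w.
Proof. by rewrite /transp eqxx. Qed.

Lemma transpR (V : eqType) (v w : V) : transp v w w = v.
Proof. by rewrite transpC transpL. Qed.

Lemma transpD (V : eqType) (v w x : V) : x != v -> x != w -> transp v w x = x.
Proof. by move=> /negPf xv /negPf xw; rewrite /transp xv xw. Qed.

Lemma transpxx (V : eqType) (v : V) : transp v v =1 id.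
Proof. by move=> x; rewrite /transp; case: eqVneq => // ->. Qed.

(** Conjugation turns a transposition of distant vertices into one along an edge. *)
Lemma transp_conj (V : eqType) (v w w' x : V) : v != w -> v != w' ->
  transp w w' (transp v w' (transp w w' x)) = transp v w x.
Proof.
move=> vw vw'; have [->|xv] := eqVneq x v.
  by rewrite (transpD vw vw') !transpL transpR.
have [->|xw] := eqVneq x w.
  by rewrite transpL !transpR transpD.
rewrite (transpD xv xw).
have [E|xw'] := eqVneq x w'; last by rewrite !transpD.
by rewrite -E in vw' *; rewrite transpR (@transpD _ v x w) ?transpL 1?eq_sym.
Qed.

(** * Colour moves and reachability *)

Section Colouring.
Variables V C : finType.
Implicit Types (X Y Z : V -> C -> bool) (e : rel V) (S : pred C).

(* [X v c] means that the colour [c] sits on the vertex [v]. *)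
Definition covering X := forall v, exists c, X v c.

(** Sliding a colour is encoded as an involution on contents, so each move is its own inverse.
    Allowing a set [S] of colours makes the full interchange the case [predT]. *)
Definition exchange S v w X : V -> C -> bool :=
  fun x c => X (if S c then transp v w x else x) c.

Definition swap_at v w X : V -> C -> bool := fun x => X (transp v w x).

Definition crowded X v := exists c d, [/\ c != d, X v c & X v d].

(* Exchanging a colour present at both ends, or at neither, is a trivial step,
   which makes [reach] symmetric without side conditions. *)
Inductive reach e X : (V -> C -> bool) -> Prop :=
| reach_refl : reach e X X
| reach_step Y i v w : reach e X Y -> e v w ->
    covering (exchange (pred1 i) v w Y) -> reach e X (exchange (pred1 i) v w Y).

Lemma exchangeK S v w : involutive (exchange S v w).
Proof.
move=> X; apply: funext => x; apply: funext => c; rewrite /exchange.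
by case: (S c) => //; rewrite transpK.
Qed.

Lemma exchangeC S v w X : exchange S v w X = exchange S w v X.
Proof.
by apply: funext => x; apply: funext => c; rewrite /exchange transpC.
Qed.

Lemma swapE v w X : swap_at v w X = exchange predT v w X.
Proof. by []. Qed.

Lemma swapK v w : involutive (swap_at v w).
Proof. exact: (@exchangeK predT). Qed.

Lemma swapC v w X : swap_at v w X = swap_at w v X.
Proof. exact: (@exchangeC predT). Qed.

Lemma swapxx v X : swap_at v v X = X.
Proof. by apply: funext => x; rewrite /swap_at transpxx. Qed.

Lemma covering_swap v w X : covering X -> covering (swap_at v w X).
Proof. by move=> cX x; apply: cX. Qed.

Lemma reach_covering e X Y : covering X -> reach e X Y -> covering Y.
Proof. by move=> cX; case. Qed.

Lemma reach_trans e X Y Z : reach e X Y -> reach e Y Z -> reach e X Z.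
Proof.
by move=> XY; elim=> // W i v w _ IH vw cW; apply: reach_step.
Qed.

Lemma reach1 e i v w X : e v w -> covering (exchange (pred1 i) v w X) ->
  reach e X (exchange (pred1 i) v w X).
Proof. by move=> vw cX; apply: reach_step => //; apply: reach_refl. Qed.

Lemma reach_sym e X Y : covering X -> reach e X Y -> reach e Y X.
Proof.
move=> cX; elim=> [|Z i v w XZ ZX vw cZ]; first exact: reach_refl.
apply: reach_trans ZX; rewrite -{2}(exchangeK (pred1 i) v w Z).
by apply: reach1 => //; rewrite exchangeK; exact: reach_covering XZ.
Qed.

Lemma reach_sub e e' X Y : subrel e e' -> reach e X Y -> reach e' X Y.
Proof.
move=> ee'; elim=> [|Z i v w _ IH vw cZ]; first exact: reach_refl.
by apply: reach_step => //; exact: ee'.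
Qed.

Lemma card_exchange S v w X c :
  #|[pred x | exchange S v w X x c]| = #|[pred x | X x c]|.
Proof.
have f_inj : injective (fun x => if S c then transp v w x else x).
  by case: (S c) => // x y /(can_inj (@transpK _ v w)).
by rewrite -!sum1_card [RHS](reindex_inj f_inj).
Qed.

(** The guards [p] on [u] and [q] on [w] do not move, so the colours of [S] can be exchanged one at
    a time without emptying an end. *)
Lemma reach_exchange e S u w X p q : e u w -> covering X ->
  ~~ S p -> X u p -> ~~ S q -> X w q -> reach e X (exchange S u w X).
Proof.
move=> uw cX Sp Xp Sq Xq.
(* The set is listed without repetition so that colours can be exchanged by induction on the
   list. *)
have -> : exchange S u w X = exchange (mem [seq c <- enum C | S c]) u w X.
  apply: funext => x; apply: funext => c; rewrite /exchange.
  by rewrite /= mem_filter mem_enum andbT.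
have : all S [seq c <- enum C | S c] by apply/allP => c; rewrite mem_filter => /andP[].
have : uniq [seq c <- enum C | S c] by rewrite filter_uniq // enum_uniq.
elim: [seq c <- enum C | S c] => [_ _|c s IH /= /andP[cs us] /andP[Sc Ss]].
  exact: reach_refl.
have -> : exchange (mem (c :: s)) u w X = exchange (pred1 c) u w (exchange (mem s) u w X).
  apply: funext => x; apply: funext => d; rewrite /exchange /= inE.
  by case: (eqVneq d c) => [->|] //=; rewrite (negPf cs).
apply: reach_step (IH us Ss) uw _ => x.
have nin d : ~~ S d -> (d == c = false) /\ (d \in s = false).
  move=> Sd; split; first by apply: contraNF Sd => /eqP ->.
  by apply: contraNF Sd => /(allP Ss).
have [pc ps] := nin _ Sp; have [qc qs] := nin _ Sq.
have [->|xu] := eqVneq x u; first by exists p; rewrite /exchange /= pc ps.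
have [->|xw] := eqVneq x w; first by exists q; rewrite /exchange /= qc qs.
have [d Xd] := cX x; exists d; rewrite /exchange /=.
by case: (d == c); case: (d \in s); rewrite ?(transpD xu xw).
Qed.

Lemma exchange_comp S S' v w X :
  exchange S v w (exchange S' v w X) = exchange [pred c | S c (+) S' c] v w X.
Proof.
apply: funext => x; apply: funext => c; rewrite /exchange /=.
by case: (S c); case: (S' c); rewrite /= ?transpK.
Qed.

Lemma eq_transp X v w x c : X v c = X w c -> X (transp v w x) c = X x c.
Proof.
by rewrite /transp; case: eqVneq => [->|_] //; case: eqVneq => [->|].
Qed.

Lemma eq_exchange S S' v w X : (forall c, X v c != X w c -> S c = S' c) ->
  exchange S v w X = exchange S' v w X.
Proof.
move=> SS'; apply: funext => x; apply: funext => c; rewrite /exchange.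
have [Xc|/SS' -> //] := eqVneq (X v c) (X w c).
by case: (S c); case: (S' c); rewrite ?(eq_transp _ Xc).
Qed.

Lemma exchange1_id i v w X : X v i = X w i -> exchange (pred1 i) v w X = X.
Proof.
move=> Xi; rewrite (@eq_exchange _ pred0) // => c /=.
by case: (eqVneq c i) => // ->; rewrite Xi eqxx.
Qed.

(** A colour common to both ends guards them while all the others are exchanged; without one, two
    colours of [u] and one of [w] guard in turn. *)
Lemma reach_swap_crowded e u w X : e u w -> covering X -> crowded X u ->
  reach e X (swap_at u w X).
Proof.
move=> uw cX [p [p' [pp' Xp Xp']]]; have [q Xq] := cX w.
have [[k Xuk Xwk]|disj] : (exists2 k, X u k & X w k) \/ (forall k, X u k -> ~~ X w k).
  have [/existsP[k /andP[]]|/existsPn no] := boolP [exists k, X u k && X w k].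
    by left; exists k.
  by right=> k Xuk; apply: contra (no k) => ->; rewrite Xuk.
- rewrite swapE (@eq_exchange _ (predC1 k)); last first.
    by move=> c /=; case: (eqVneq c k) => //= ->; rewrite Xuk Xwk.
  by apply: (@reach_exchange _ _ _ _ _ k k) => //=; rewrite eqxx.
(* No colour is shared. First [p] crosses, guarded by [p'] and [q]; then everything except [p] and
   [p'], guarded by [p'] and [p]; last [p'], guarded by [q], now on [u], and [p]. *)
have qp : q != p by apply: contraTneq Xq => ->; exact: disj.
have qp' : q != p' by apply: contraTneq Xq => ->; exact: disj.
have p'p : p' != p by rewrite eq_sym.
have R1 : reach e X (exchange (pred1 p) u w X).
  by apply: (@reach_exchange _ _ _ _ _ p' q) => //=.
have c1 := reach_covering cX R1.
apply: (reach_trans R1).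
have R2 : reach e (exchange (pred1 p) u w X)
  (exchange [pred c | (c != p) && (c != p')] u w (exchange (pred1 p) u w X)).
  apply: (@reach_exchange _ _ _ _ _ p' p) => //=; rewrite ?eqxx ?andbF // /exchange /=.
    by rewrite (negPf p'p).
  by rewrite eqxx transpR.
have c2 := reach_covering c1 R2.
apply: (reach_trans R2).
have -> : swap_at u w X = exchange (pred1 p') u w
  (exchange [pred c | (c != p) && (c != p')] u w (exchange (pred1 p) u w X)).
  rewrite !exchange_comp swapE; apply: eq_exchange => c _ /=.
  case: (eqVneq c p') => [->|_] /=; first by rewrite (negPf p'p).
  by case: (eqVneq c p).
apply: (@reach_exchange _ _ _ _ _ q p) => //=.
  by rewrite /exchange /= qp qp' (negPf qp) transpL.
by rewrite /exchange /= eqxx /= transpR.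
Qed.

Lemma reach_fix e X Y u : (forall v w, e v w -> (u != v) && (u != w)) ->
  reach e X Y -> Y u = X u.
Proof.
move=> eu; elim=> // Z i v w _ IH /eu/andP[uv uw] _; rewrite -IH.
by apply: funext => c; rewrite /exchange; case: ifP; rewrite ?transpD.
Qed.

(** * Moves away from a pair of vertices *)

Definition avoid u w e : rel V :=
  [rel x y | [&& e x y, x \notin [:: u; w] & y \notin [:: u; w]]].

Lemma avoid_sub u w e : subrel (avoid u w e) e.
Proof. by move=> x y /andP[]. Qed.

Lemma avoid_sym u w e : symmetric e -> symmetric (avoid u w e).
Proof. by move=> es x y; rewrite /avoid /= es [(x \notin _) && _]andbC. Qed.

(** Transpositions with disjoint supports commute. *)
Lemma swap_exchange S u w v v' X : v \notin [:: u; w] -> v' \notin [:: u; w] ->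
  swap_at u w (exchange S v v' X) = exchange S v v' (swap_at u w X).
Proof.
rewrite !inE !negb_or => /andP[vu vw] /andP[v'u v'w].
apply: funext => x; apply: funext => c; rewrite /swap_at /exchange.
case: (S c) => //; congr (X _ c).
have [->|xv] := eqVneq x v; first by rewrite (transpD vu vw) !transpL transpD.
have [->|xv'] := eqVneq x v'; first by rewrite (transpD v'u v'w) !transpR transpD.
rewrite (transpD xv xv') transpD //.
  by rewrite /transp; case: ifP => _; [|case: ifP => _ //]; rewrite eq_sym.
by rewrite /transp; case: ifP => _; [|case: ifP => _ //]; rewrite eq_sym.
Qed.

Lemma reach_swap_avoid e u w X Y : reach (avoid u w e) X Y ->
  reach e (swap_at u w X) (swap_at u w Y).
Proof.
elim=> [|Z i v v' _ IH /and3P[vv' vN v'N] cZ]; first exact: reach_refl.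
rewrite swap_exchange //; apply: reach_step => //.
by rewrite -swap_exchange //; exact: covering_swap.
Qed.

(** Moves off [u] and [w] can be replayed after the interchange: go to [Y], interchange there, then
    undo the moves. *)
Lemma reach_conj_swap e u w X Y : covering X -> reach (avoid u w e) X Y ->
  reach e Y (swap_at u w Y) -> reach e X (swap_at u w X).
Proof.
move=> cX XY YY; have XY' := reach_sub (@avoid_sub u w e) XY.
apply: reach_trans XY' (reach_trans YY _).
apply: reach_sym; last exact: reach_swap_avoid.
exact: covering_swap.
Qed.

(** * Transporting crowding and colours along paths *)

Lemma crowded_neq X v c : crowded X v -> exists2 d, d != c & X v d.
Proof.
move=> [d [d' [dd' Xd Xd']]]; have [E|?] := eqVneq d c; last by exists d.
by exists d' => //; rewrite -E eq_sym.
Qed.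

Lemma not_crowded X v c : X v c -> ~ crowded X v -> X v =1 pred1 c.
Proof.
move=> Xc nc d /=; case: eqVneq => [-> //|dc]; apply/negbTE/negP => Xd.
by apply: nc; exists d, c.
Qed.

Lemma single_neq X u w a b : a != b -> X u =1 pred1 a -> X w =1 pred1 b -> u != w.
Proof.
by move=> ab Xu Xw; apply: contra_neq ab => E; apply/eqP; rewrite -[_ == _]Xw -E Xu /=.
Qed.

(** A second colour stays behind on [v], while [i] joins a different colour already on [w]. Only [v]
    loses a colour. *)
Lemma crowded_step e i X v w : e v w -> covering X -> crowded X v -> X v i ->
  ~~ X w i -> let Y := exchange (pred1 i) v w X in
  [/\ reach e X Y, crowded Y w, Y w i & forall x c, x != v -> X x c -> Y x c].
Proof.
move=> vw cX cv Xi Xwi Y.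
have [d di Xd] := crowded_neq i cv.
have [j Xj] := cX w.
have ji : j != i by apply: contraTneq Xj => ->.
have Ywi : Y w i by rewrite /Y /exchange /= eqxx transpR.
split=> //; first by apply: (@reach_exchange _ _ _ _ _ d j).
  by exists j, i; split=> //; rewrite /Y /exchange /= (negPf ji).
move=> x c xv Xx; rewrite /Y /exchange /=; case: eqVneq => // E.
by rewrite transpD //; apply: contraNneq Xwi => <-; rewrite -E.
Qed.

(** Each step slides a colour absent from the next vertex of the path, or nothing if that vertex is
    already crowded. *)
Lemma reach_walk e X x y : covering X -> crowded X x -> connect e x y ->
  exists Y, [/\ reach e X Y, crowded Y y & forall c, X y c -> Y y c].
Proof.
move=> + + /connectP[p]; elim: p X x => [|x1 p IH] X x cX Xx /=.
  by move=> _ ->; exists X; split=> //; exact: reach_refl.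
move=> /andP[xx1 px1] yE.
(* Stopping at the first visit to [y] ensures that [y] never loses a colour. *)
have [yx|yx] := eqVneq y x.
  by exists X; rewrite yx; split=> //; exact: reach_refl.
have [Xx1|nXx1] := pselect (crowded X x1); first exact: IH px1 yE.
have [c Xc] := cX x1; have [d dc Xd] := crowded_neq c Xx.
have Xx1d : ~~ X x1 d by rewrite (not_crowded Xc nXx1).
have [R cr _ XY] := crowded_step xx1 cX Xx Xd Xx1d.
have [Y [RY crY YY]] := IH _ _ (reach_covering cX R) cr px1 yE.
exists Y; split=> //; first exact: reach_trans RY.
by move=> c' Xyc'; apply: YY; apply: XY.
Qed.

(** If the next vertex lacks [k], then [k] slides there. Otherwise only the crowding has to be
    brought, and [reach_walk] preserves the copy of [k] found there. *)
Lemma reach_carry e X x y k : covering X -> crowded X x -> X x k ->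
  connect e x y -> exists Y, [/\ reach e X Y, crowded Y y & Y y k].
Proof.
move=> + + + /connectP[p]; elim: p X x => [|x1 p IH] X x cX Xx Xk /=.
  by move=> _ ->; exists X; split=> //; exact: reach_refl.
move=> /andP[xx1 px1] yE.
have [Xx1k|Xx1k] := boolP (X x1 k).
  have [Y [RY crY YY]] := reach_walk cX Xx (connect1 xx1).
  have [Z [RZ crZ Zk]] := IH _ _ (reach_covering cX RY) crY (YY _ Xx1k) px1 yE.
  by exists Z; split=> //; exact: reach_trans RZ.
have [R cr Yk _] := crowded_step xx1 cX Xx Xk Xx1k.
have [Z [RZ crZ Zk]] := IH _ _ (reach_covering cX R) cr Yk px1 yE.
by exists Z; split=> //; exact: reach_trans RZ.
Qed.

(** The path is cut just before its first visit to [u] or [w]. *)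
Lemma exit_path e u w x : connect e x u -> x \notin [:: u; w] ->
  exists y t, [/\ connect (avoid u w e) x y, y \notin [:: u; w],
                  t \in [:: u; w] & e y t].
Proof.
move=> /connectP[p]; elim: p x => [|x1 p IH] x /=.
  by move=> _ ->; rewrite !inE eqxx.
move=> /andP[xx1 px1] uE xN.
have [x1N|x1N] := boolP (x1 \in [:: u; w]); first by exists x, x1.
have [y [t [xy yN tN yt]]] := IH _ px1 uE x1N.
exists y, t; split=> //; apply: connect_trans xy; apply: connect1.
by rewrite /avoid /= xx1 xN.
Qed.

(* The colour [k], parked with [a] on [u], keeps [u] covered while [a] and [b]
   trade places. *)
Lemma swap_third_near e u w y a b k X : e y u -> e u w -> covering X ->
  y \notin [:: u; w] -> a != b -> k != a -> k != b ->
  X u =1 pred1 a -> X w =1 pred1 b -> crowded X y -> X y k ->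
  reach e X (swap_at u w X).
Proof.
move=> yu uw cX yN ab ka kb Xu Xw Xy Xk.
have ba : b != a by rewrite eq_sym.
have [ak bk] : a != k /\ b != k by rewrite ![_ == k]eq_sym.
have [d dk Xd] := crowded_neq k Xy.
have R1 : reach e X (exchange (pred1 k) y u X).
  by apply: (@reach_exchange _ _ _ _ _ d a); rewrite //= Xu /=.
set X1 := exchange _ _ _ _ in R1; have c1 := reach_covering cX R1.
move: yN; rewrite !inE !negb_or => /andP[yu' yw'].
have X1uk : X1 u k by rewrite /X1 /exchange /= eqxx transpR.
have X1a c : c != k -> X1^~ c = X^~ c.
  by move=> ck; apply: funext => x; rewrite /X1 /exchange /= (negPf ck).
have R2 : reach e X1 (exchange (pred1 a) u w X1).
  apply: (@reach_exchange _ _ _ _ _ k b) => //=.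
  by rewrite (congr1 (@^~ w) (X1a b bk)) Xw /=.
set X2 := exchange _ _ _ _ in R2; have c2 := reach_covering c1 R2.
have R3 : reach e X2 (exchange (pred1 b) u w X2).
  apply: (@reach_exchange _ _ _ _ _ k a) => //=.
    by rewrite /X2 /exchange /= (negPf ka).
  by rewrite /X2 /exchange /= eqxx transpR (congr1 (@^~ u) (X1a a ak)) Xu /=.
set X3 := exchange _ _ _ _ in R3; have c3 := reach_covering c2 R3.
have -> : swap_at u w X = exchange (pred1 k) y u X3.
  apply: funext => x; apply: funext => c.
  rewrite /X3 /X2 /X1 /swap_at /exchange /=.
  (* Colours other than [a] and [b] are on neither [u] nor [w], so the interchange leaves them in
     place. *)
  have N c' : c' != a -> c' != b -> X (transp u w x) c' = X x c'.
    by move=> ca cb; apply: eq_transp; rewrite Xu Xw /= (negPf ca) (negPf cb).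
  case: (eqVneq c k) => [->|ck]; first by rewrite (negPf ka) (negPf kb) transpK N.
  case: (eqVneq c b) => [->|cb]; first by rewrite (negPf ba).
  by case: (eqVneq c a) => // ca; rewrite N.
apply: reach_trans R1 (reach_trans R2 (reach_trans R3 _)).
apply: (@reach_exchange _ _ _ _ _ d b) => //=.
  by rewrite /X3 /X2 /X1 /exchange /= (negPf dk) !transpD //; do 2!case: (d == _).
by rewrite /X3 /X2 /exchange /= eqxx (negPf ba) transpL (congr1 (@^~ w) (X1a b bk)) Xw /=.
Qed.

(** * Interchanging the contents of the two ends of an edge *)

Section Connected.
Variables (e : rel V).
Hypotheses (e_sym : symmetric e) (e_conn : forall x y, connect e x y).

(** Off [u] and [w], the crowding walks from [z] to [x] and then carries [k] to a neighbour of [u]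
    or [w]. There [swap_third_near] applies, and the preparation is undone by conjugation. *)
Lemma swap_third_connected u w a b k x z X : e u w -> covering X -> a != b ->
  k != a -> k != b -> X u =1 pred1 a -> X w =1 pred1 b ->
  crowded X z -> X x k -> connect (avoid u w e) z x ->
  reach e X (swap_at u w X).
Proof.
move=> uw cX ab ka kb Xu Xw Xz Xk zx.
have xN : x \notin [:: u; w].
  rewrite !inE negb_or; apply/andP; split; apply: contraTneq Xk => ->.
    by rewrite Xu /=.
  by rewrite Xw /=.
have [y [t [xy yN tuw yt]]] := exit_path (e_conn x u) xN.
have [Y [RY Yx YS]] := reach_walk cX Xz zx.
have cY := reach_covering cX RY.
have [Z [RZ Zy Zk]] := reach_carry cY Yx (YS _ Xk) xy.
have cZ := reach_covering cY RZ.
have RXZ := reach_trans RY RZ.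
apply: (reach_conj_swap cX RXZ).
have Zu : Z u =1 pred1 a.
  move=> c; rewrite (reach_fix _ RXZ) // => v v' /and3P[_].
  by rewrite !inE !negb_or ![_ == u]eq_sym => /andP[-> _] /andP[-> _].
have Zw : Z w =1 pred1 b.
  move=> c; rewrite (reach_fix _ RXZ) // => v v' /and3P[_].
  by rewrite !inE !negb_or ![_ == w]eq_sym => /andP[_ ->] /andP[_ ->].
move: tuw yt; rewrite !inE => /orP[/eqP->|/eqP->] yt.
  exact: (swap_third_near yt uw cZ yN ab ka kb Zu Zw).
rewrite swapC; apply: (swap_third_near yt _ cZ _ _ kb ka Zw Zu) => //.
- by rewrite e_sym.
- by move: yN; rewrite !inE orbC.
- by rewrite eq_sym.
Qed.

Definition third_colour X := forall a b, exists k x, [/\ k != a, k != b & X x k].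

Lemma reach_card e' X Y c : reach e' X Y ->
  #|[pred x | Y x c]| = #|[pred x | X x c]|.
Proof. by elim=> // Z i v w _ <- _ _; rewrite card_exchange. Qed.

Lemma reach_third e' X Y : reach e' X Y -> third_colour X -> third_colour Y.
Proof.
move=> XY tX a b; have [k [x [ka kb Xk]]] := tX a b.
have : 0 < #|[pred x | Y x k]|.
  by rewrite (reach_card _ XY); apply/card_gt0P; exists x.
by case/card_gt0P => y Yk; exists k, y.
Qed.

(** A path to [x] off [u] and [w] cannot meet [v], which is not connected to [x] off these two
    vertices; hence it also avoids [v] and [u]. *)
Lemma connect_avoid_switch u v w y x : ~~ connect (avoid u w e) v x ->
  connect (avoid u w e) y x -> connect (avoid v u e) y x.
Proof.
move=> vx /connectP[p]; elim: p y => [|y1 p IH] y /=.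
  by move=> _ ->; exact: connect0.
move=> /andP[yy1 py1] xE.
have y1x : connect (avoid u w e) y1 x by apply/connectP; exists p.
have yx : connect (avoid u w e) y x := connect_trans (connect1 yy1) y1x.
apply: connect_trans (IH _ py1 xE); apply: connect1.
have [y1v yv] : y1 != v /\ y != v.
  by split; apply: contraNneq vx => <-.
move: yy1; rewrite /avoid /= !inE !negb_or y1v yv.
by move=> /and3P[-> /andP[-> _] /andP[-> _]].
Qed.

(* Moving [b] from [v] to [u] and then [a] from [u] to [w] makes [w] crowded and
   turns the transposition of [u] and [w] into that of [v] and [u], where the
   colour [k] is now available. *)
Lemma swap_across u w v y x a b k X : e v u -> e u w -> e y w -> covering X ->
  v \notin [:: u; w] -> y \notin [:: u; w] ->
  a != b -> k != a -> k != b ->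
  X v =1 pred2 a b -> X u =1 pred1 a -> X w =1 pred1 b ->
  X x k -> connect (avoid u w e) y x -> ~~ connect (avoid u w e) v x ->
  reach e X (swap_at u w X).
Proof.
move=> vu uw yw cX vN yN ab ka kb Xv Xu Xw Xk yx vx.
have uw' := single_neq ab Xu Xw.
move: (vN); rewrite !inE !negb_or => /andP[vu' vw'].
have ne := (negPf vu', negPf vw', negPf uw', negPf ab, negPf ka, negPf kb).
have ne' := (ne, eq_sym u v, eq_sym w v, eq_sym w u, eq_sym b a).
have R1 : reach e X (exchange (pred1 b) v u X).
  by apply: (@reach_exchange _ _ _ _ _ a a); rewrite //= ?ne ?Xv ?Xu /= ?eqxx.
set X1 := exchange _ _ _ _ in R1; have c1 := reach_covering cX R1.
have R2 : reach e X1 (exchange (pred1 a) u w X1).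
  by apply: (@reach_exchange _ _ _ _ _ b b);
    rewrite //= /X1 /exchange /transp /= !(ne', eqxx, Xv, Xw) //= !eqxx orbT.
set X2 := exchange _ _ _ _ in R2; have c2 := reach_covering c1 R2.
have X2v : X2 v =1 pred1 a.
  move=> c; rewrite /X2 /X1 /exchange /transp /=.
  case: (eqVneq c a) => [->|ca]; first by rewrite !(ne', eqxx, Xv) //= ?eqxx.
  case: (eqVneq c b) => [->|cb]; first by rewrite !(ne', eqxx, Xu) /= ?ne'.
  by rewrite Xv /= (negPf ca) (negPf cb).
have X2u : X2 u =1 pred1 b.
  move=> c; rewrite /X2 /X1 /exchange /transp /=.
  case: (eqVneq c a) => [->|ca]; first by rewrite !(ne', eqxx, Xw) //= ?ne'.
  case: (eqVneq c b) => [->|cb]; first by rewrite !(ne', eqxx, Xv) /= eqxx orbT.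
  by rewrite Xu /= (negPf ca).
have X2wa : X2 w a.
  by rewrite /X2 /X1 /exchange /transp /= !(ne', eqxx) /= Xu /= eqxx.
have X2wb : X2 w b.
  by rewrite /X2 /X1 /exchange /transp /= !(ne', eqxx) /= Xw /= eqxx.
have X2w : crowded X2 w by exists a, b.
have X2k : X2 x k by rewrite /X2 /X1 /exchange /= !ne.
have wN : w \notin [:: v; u] by rewrite !inE negb_or ![w == _]eq_sym vw' uw'.
(* The crowded vertex [w] leads to [x] through its neighbour [y], off [v] and [u]. *)
have wx : connect (avoid v u e) w x.
  have yx' := connect_avoid_switch vx yx.
  apply: connect_trans yx'; apply: connect1; rewrite /avoid /= e_sym yw wN /=.
  move: yN; rewrite !inE !negb_or => /andP[-> _]; rewrite andbT.
  by apply: contraNneq vx => <-.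
have R3 := swap_third_connected vu c2 ab ka kb X2v X2u X2w X2k wx.
set X3 := swap_at _ _ _ in R3; have c3 := reach_covering c2 R3.
(* The first two moves are undone in reverse order, with [a] and [b] in each other's role. *)
have R4 : reach e X3 (exchange (pred1 b) u w X3).
  apply: (@reach_exchange _ _ _ _ _ a a); rewrite //= ?ne' //.
    by rewrite /X3 /swap_at transpR X2v /= eqxx.
  by rewrite /X3 /swap_at transpD // eq_sym.
set X4 := exchange _ _ _ _ in R4; have c4 := reach_covering c3 R4.
have R5 : reach e X4 (exchange (pred1 a) v u X4).
  apply: (@reach_exchange _ _ _ _ _ b b); rewrite //= ?ne' //.
    by rewrite /X4 /exchange /= eqxx transpD // /X3 /swap_at transpL X2u /= eqxx.
  by rewrite /X4 /exchange /= eqxx transpL /X3 /swap_at transpD // eq_sym.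
suff -> : swap_at u w X = exchange (pred1 a) v u X4.
  exact: reach_trans R1 (reach_trans R2 (reach_trans R3 (reach_trans R4 R5))).
apply: funext => z; apply: funext => c; rewrite /X4 /X3 /X2 /X1 /swap_at /exchange /=.
case: (eqVneq c a) => [->|ca]; first by rewrite ne' transpK.
case: (eqVneq c b) => [->|cb]; first by rewrite transpK.
by rewrite !eq_transp // ?Xv ?Xu ?Xw /= (negPf ca) (negPf cb).
Qed.

(* Once [y] is crowded, [k] can serve both the transposition of [v] and [u] and
   that of [u] and [w]. *)
Lemma swap_beside u w v y x a b k X : e v u -> e u w -> e y u -> covering X ->
  v \notin [:: u; w] -> y \notin [:: u; w] ->
  a != b -> k != a -> k != b ->
  X v =1 pred2 a b -> X u =1 pred1 a -> X w =1 pred1 b ->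
  X x k -> connect (avoid u w e) y x -> ~~ connect (avoid u w e) v x ->
  reach e X (swap_at u w X).
Proof.
move=> vu uw yu cX vN yN ab ka kb Xv Xu Xw Xk yx vx.
have [Xy|nXy] := pselect (crowded X y).
  exact: (swap_third_connected uw cX ab ka kb Xu Xw Xy Xk yx).
have uy : e u y by rewrite e_sym.
have [d Xyd] := cX y.
have {Xyd nXy} Xy := not_crowded Xyd nXy.
have uw' := single_neq ab Xu Xw.
have yx' := connect_avoid_switch vx yx.
have yv : y != v by apply: contraNneq vx => <-.
move: (vN) (yN); rewrite !inE !negb_or => /andP[vu' vw'] /andP[yu' yw'].
have ba : b != a by rewrite eq_sym.
have ne := (negPf vu', negPf vw', negPf uw', negPf ab, negPf ka, negPf kb,
  negPf ba, negPf yu', negPf yw', negPf yv).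
have ne' := (ne, eq_sym u v, eq_sym w v, eq_sym w u, eq_sym u y, eq_sym w y, eq_sym v y).
have R1 : reach e X (exchange (pred1 b) v u X).
  by apply: (@reach_exchange _ _ _ _ _ a a); rewrite //= ?ne ?Xv ?Xu /= ?eqxx.
set X1 := exchange _ _ _ _ in R1; have c1 := reach_covering cX R1.
have X1v : X1 v =1 pred1 a.
  move=> c; rewrite /X1 /exchange /=; case: (eqVneq c b) => [->|cb].
    by rewrite transpL Xu.
  by rewrite Xv /= (negPf cb) orbF.
have X1u : X1 u =1 pred2 a b.
  move=> c; rewrite /X1 /exchange /=; case: (eqVneq c b) => [->|cb].
    by rewrite transpR Xv /= eqxx.
  by rewrite Xu /= orbF.
have X1w : X1 w =1 pred1 b.
  move=> c; rewrite -Xw /X1 /exchange; case: ifP => // _.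
  by rewrite transpD // eq_sym.
have X1y : X1 y =1 pred1 d.
  by move=> c; rewrite -Xy /X1 /exchange; case: ifP => // _; rewrite transpD.
have X1k : X1 x k by rewrite /X1 /exchange /= ne.
have swk Z t t' z : Z z k -> Z t k = false -> Z t' k = false -> swap_at t t' Z z k.
  by move=> Zk Zt Zt'; rewrite /swap_at eq_transp // Zt Zt'.
(* The colour pushed from [u] to [y] must be absent from [y]: it is [b] if [y] carries [a], and [a]
   otherwise. In the first case [v] and [u] then both carry [a], so the interchange of [u] and [w]
   comes first. *)
have [da|da] := eqVneq d a.
- subst d.
  have R2 : reach e X1 (exchange (pred1 b) u y X1).
    by apply: (@reach_exchange _ _ _ _ _ a a); rewrite //= ?ne ?X1u ?X1y /= ?eqxx.
  set X2 := exchange _ _ _ _ in R2; have c2 := reach_covering c1 R2.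
  have X2u : X2 u =1 pred1 a.
    move=> c; rewrite /X2 /exchange /=; case: (eqVneq c b) => [->|cb].
      by rewrite transpL X1y.
    by rewrite X1u /= (negPf cb) orbF.
  have X2v : X2 v =1 pred1 a.
    move=> c; rewrite -X1v /X2 /exchange; case: ifP => // _.
    by rewrite transpD // eq_sym.
  have X2w : X2 w =1 pred1 b.
    move=> c; rewrite -X1w /X2 /exchange; case: ifP => // _.
    by rewrite transpD // eq_sym.
  have X2ya : X2 y a by rewrite /X2 /exchange /= ne X1y /=.
  have X2yb : X2 y b by rewrite /X2 /exchange /= eqxx transpR X1u /= eqxx orbT.
  have X2y : crowded X2 y by exists a, b.
  have X2k : X2 x k by rewrite /X2 /exchange /= ne.
  have R3 := swap_third_connected uw c2 ab ka kb X2u X2w X2y X2k yx.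
  set X3 := swap_at _ _ _ in R3; have c3 := reach_covering c2 R3.
  have X3u : X3 u =1 pred1 b by rewrite /X3 /swap_at transpL.
  have X3v : X3 v =1 pred1 a by rewrite /X3 /swap_at transpD.
  have X3y : X3 y = X2 y by rewrite /X3 /swap_at transpD.
  have X3k : X3 x k by apply: swk => //; rewrite ?X2u ?X2w /= ne.
  have X3y' : crowded X3 y by case: X2y => c [c']; rewrite -X3y; exists c, c'.
  have R4 := swap_third_connected vu c3 ab ka kb X3v X3u X3y' X3k yx'.
  set X4 := swap_at _ _ _ in R4; have c4 := reach_covering c3 R4.
  have X4y : X4 y = X2 y by rewrite /X4 /swap_at transpD.
  have R5 : reach e X4 (exchange (pred1 b) u y X4).
    apply: (@reach_exchange _ _ _ _ _ a a); rewrite //= ?ne ?X4y //.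
    by rewrite /X4 /swap_at transpR X3v /=.
  set X5 := exchange _ _ _ _ in R5; have c5 := reach_covering c4 R5.
  have R6 : reach e X5 (exchange (pred1 a) v u X5).
    apply: (@reach_exchange _ _ _ _ _ b b); rewrite //= ?ne //; rewrite /X5 /exchange /= eqxx.
      by rewrite transpD // 1?eq_sym // /X4 /swap_at transpL X3u /=.
    by rewrite transpL X4y.
  suff -> : swap_at u w X = exchange (pred1 a) v u X5.
    exact: reach_trans R1 (reach_trans R2 (reach_trans R3
      (reach_trans R4 (reach_trans R5 R6)))).
  apply: funext => z; apply: funext => c.
  rewrite /X5 /X4 /X3 /X2 /X1 /swap_at /exchange /=.
  case: (eqVneq c a) => [->|ca]; first by rewrite ne' transpK.
  case: (eqVneq c b) => [->|cb]; last first.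
    by rewrite [in RHS]eq_transp // ?eq_transp // ?Xu ?Xw ?Xv /= ?(negPf ca) ?(negPf cb).
  have [->|zu] := eqVneq z u; first by rewrite /transp !(ne', eqxx) Xw Xv /= eqxx orbT.
  have [->|zv] := eqVneq z v; first by rewrite /transp !(ne', eqxx) Xw Xv /= eqxx orbT.
  have [->|zw] := eqVneq z w; first by rewrite /transp !(ne', eqxx) Xu Xy.
  have [->|zy] := eqVneq z y; first by rewrite /transp !(ne', eqxx) Xu Xy.
  by rewrite !transpD.
(* Once [a] has left [u], both [u] and [w] carry [b], so the interchange of [v] and [u] comes
   first. *)
- have R2 : reach e X1 (exchange (pred1 a) u y X1).
    by apply: (@reach_exchange _ _ _ _ _ b d); rewrite //= ?ne ?X1u ?X1y /= ?eqxx ?orbT.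
  set X2 := exchange _ _ _ _ in R2; have c2 := reach_covering c1 R2.
  have X2u : X2 u =1 pred1 b.
    move=> c; rewrite /X2 /exchange /=; case: (eqVneq c a) => [->|ca].
      by rewrite transpL X1y ne /= eq_sym (negPf da).
    by rewrite X1u /= (negPf ca).
  have X2v : X2 v =1 pred1 a.
    move=> c; rewrite -X1v /X2 /exchange; case: ifP => // _.
    by rewrite transpD // eq_sym.
  have X2w : X2 w =1 pred1 b.
    move=> c; rewrite -X1w /X2 /exchange; case: ifP => // _.
    by rewrite transpD // eq_sym.
  have X2ya : X2 y a by rewrite /X2 /exchange /= eqxx transpR X1u /= eqxx.
  have X2yd : X2 y d by rewrite /X2 /exchange /= (negPf da) X1y /=.
  have X2y : crowded X2 y by exists d, a.
  have X2k : X2 x k by rewrite /X2 /exchange /= ne.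
  have R3 := swap_third_connected vu c2 ab ka kb X2v X2u X2y X2k yx'.
  set X3 := swap_at _ _ _ in R3; have c3 := reach_covering c2 R3.
  have X3u : X3 u =1 pred1 a by rewrite /X3 /swap_at transpR.
  have X3w : X3 w =1 pred1 b by rewrite /X3 /swap_at transpD // eq_sym.
  have X3y : X3 y = X2 y by rewrite /X3 /swap_at transpD.
  have X3k : X3 x k by apply: swk => //; rewrite ?X2u ?X2v /= ne.
  have X3y' : crowded X3 y by case: X2y => c [c']; rewrite -X3y; exists c, c'.
  have R4 := swap_third_connected uw c3 ab ka kb X3u X3w X3y' X3k yx.
  set X4 := swap_at _ _ _ in R4; have c4 := reach_covering c3 R4.
  have X4u : X4 u =1 pred1 b by rewrite /X4 /swap_at transpL.
  have X4y : X4 y = X2 y by rewrite /X4 /swap_at transpD.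
  have X4v : X4 v =1 pred1 b by rewrite /X4 /swap_at transpD // /X3 /swap_at transpL.
  have R5 : reach e X4 (exchange (pred1 a) u y X4).
    apply: (@reach_exchange _ _ _ _ _ b d); rewrite //= ?ne ?X4y //.
    by rewrite X4u /=.
  set X5 := exchange _ _ _ _ in R5; have c5 := reach_covering c4 R5.
  have R6 : reach e X5 (exchange (pred1 a) v u X5).
    apply: (@reach_exchange _ _ _ _ _ b b); rewrite //= ?ne //; rewrite /X5 /exchange /= ne.
      by rewrite X4v /=.
    by rewrite X4u /=.
  suff -> : swap_at u w X = exchange (pred1 a) v u X5.
    exact: reach_trans R1 (reach_trans R2 (reach_trans R3
      (reach_trans R4 (reach_trans R5 R6)))).
  apply: funext => z; apply: funext => c.
  rewrite /X5 /X4 /X3 /X2 /X1 /swap_at /exchange /=.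
  case: (eqVneq c b) => [->|cb]; first by rewrite ne' transpK.
  case: (eqVneq c a) => [->|ca]; last first.
    by rewrite [in RHS]eq_transp // ?eq_transp // ?Xu ?Xw ?Xv /= ?(negPf ca) ?(negPf cb).
  have [->|zu] := eqVneq z u; first by rewrite /transp !(ne', eqxx) Xw Xy /= ne eq_sym (negPf da).
  have [->|zv] := eqVneq z v; first by rewrite /transp !(ne', eqxx) Xu Xv /= eqxx.
  have [->|zw] := eqVneq z w; first by rewrite /transp !(ne', eqxx) Xu Xv /= eqxx.
  have [->|zy] := eqVneq z y; first by rewrite /transp !(ne', eqxx) Xw Xy /= ne eq_sym (negPf da).
  by rewrite !transpD.
Qed.

(** If a third colour is on [v] or connected to it off [u] and [w], it is used directly. Otherwise
    [v] carries exactly [a] and [b], and the component of [x] touches [u] or [w]; these are the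
    cases of [swap_beside] and [swap_across]. *)
Lemma swap_near_crowded u w v a b X : e u w -> covering X -> third_colour X ->
  a != b -> X u =1 pred1 a -> X w =1 pred1 b -> v \notin [:: u; w] ->
  e v u -> crowded X v -> reach e X (swap_at u w X).
Proof.
move=> uw cX tX ab Xu Xw vN vu Xv.
have [k [x [ka kb Xk]]] := tX a b.
have [vx|vx] := boolP (connect (avoid u w e) v x).
  exact: (swap_third_connected uw cX ab ka kb Xu Xw Xv Xk vx).
have xN : x \notin [:: u; w].
  rewrite !inE negb_or; apply/andP; split; apply: contraTneq Xk => ->.
    by rewrite Xu /=.
  by rewrite Xw /=.
have [[c Xvc /norP[ca cb]]|sub] :
    (exists2 c, X v c & ~~ ((c == a) || (c == b))) \/
    forall c, X v c -> (c == a) || (c == b).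
  have [/existsP[c /andP[]]|/existsPn no] :=
    boolP [exists c, X v c && ~~ ((c == a) || (c == b))]; first by left; exists c.
  by right=> c Xvc; have := no c; rewrite Xvc /= negbK.
  exact: (swap_third_connected uw cX ab ca cb Xu Xw Xv Xvc (connect0 _ _)).
(* Being crowded, [v] has a colour other than [a], necessarily [b], and one other than [b],
   necessarily [a]. *)
have Xvab : X v =1 pred2 a b.
  have [c ca Xvc] := crowded_neq a Xv; have [d db Xvd] := crowded_neq b Xv.
  have cb : c = b by have := sub _ Xvc; rewrite (negPf ca) => /eqP.
  have da : d = a by have := sub _ Xvd; rewrite (negPf db) orbF => /eqP.
  move=> c' /=; apply/idP/idP; first exact: sub.
  by case/orP => /eqP ->; rewrite -?cb -?da.
have [y [t [xy yN tuw yt]]] := exit_path (e_conn x u) xN.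
have yx : connect (avoid u w e) y x.
  by rewrite (sym_connect_sym (avoid_sym u w e_sym)).
move: tuw yt; rewrite !inE => /orP[/eqP->|/eqP->] yt.
  exact: swap_beside vu uw yt cX vN yN ab ka kb Xvab Xu Xw Xk yx vx.
exact: swap_across vu uw yt cX vN yN ab ka kb Xvab Xu Xw Xk yx vx.
Qed.

(** Only distinct single colours at the ends need work: the crowding is first walked, off [u] and
    [w], to a neighbour of one of them. *)
Lemma reach_swap_edge u w X : e u w -> covering X -> third_colour X ->
  (exists z, crowded X z) -> reach e X (swap_at u w X).
Proof.
move=> uw cX tX [z Xz].
have [Xu|nXu] := pselect (crowded X u); first exact: reach_swap_crowded.
have [Xw|nXw] := pselect (crowded X w).
  by rewrite swapC; apply: reach_swap_crowded => //; rewrite e_sym.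
have [a Xa] := cX u; have [b Xb] := cX w.
have Xu := not_crowded Xa nXu; have Xw := not_crowded Xb nXw.
have [ab|ab] := eqVneq a b.
  suff -> : swap_at u w X = X by exact: reach_refl.
  apply: funext => x; apply: funext => c; rewrite /swap_at eq_transp //.
  by rewrite Xu Xw ab.
have zN : z \notin [:: u; w].
  by rewrite !inE negb_or; apply/andP; split; apply/eqP => E; [apply: nXu|apply: nXw]; rewrite -E.
have [v [t [zv vN tuw vt]]] := exit_path (e_conn z u) zN.
have [Y [RY Yv _]] := reach_walk cX Xz zv.
have RY' := reach_sub (@avoid_sub _ _ _) RY.
have cY := reach_covering cX RY; have tY := reach_third RY tX.
apply: (reach_conj_swap cX RY).
have Yu : Y u =1 pred1 a.
  move=> c; rewrite (reach_fix _ RY) // => y y' /and3P[_].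
  by rewrite !inE !negb_or ![_ == u]eq_sym => /andP[-> _] /andP[-> _].
have Yw : Y w =1 pred1 b.
  move=> c; rewrite (reach_fix _ RY) // => y y' /and3P[_].
  by rewrite !inE !negb_or ![_ == w]eq_sym => /andP[_ ->] /andP[_ ->].
move: tuw vt; rewrite !inE => /orP[/eqP->|/eqP->] vt.
  exact: (swap_near_crowded uw cY tY ab Yu Yw vN vt Yv).
rewrite swapC; apply: (swap_near_crowded _ cY tY _ Yw Yu _ vt Yv).
- by rewrite e_sym.
- by rewrite eq_sym.
- by move: vN; rewrite !inE orbC.
Qed.

(** * Placements with prescribed numbers of tokens *)

Variable l : C -> nat.
Hypotheses (l_gt0 : forall c, 0 < l c) (l_sum : #|V| < \sum_c l c) (C_ge3 : 2 < #|C|).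

Definition config X := covering X /\ forall c, #|[pred x | X x c]| = l c.

Lemma reach_config e' X Y : config X -> reach e' X Y -> config Y.
Proof.
move=> [cX lX] XY; split; first exact: reach_covering XY.
by move=> c; rewrite (reach_card _ XY).
Qed.

(** Pigeonhole, by counting the tokens by colour and by vertex. *)
Lemma config_crowded X : config X -> exists z, crowded X z.
Proof.
move=> [cX lX]; apply: contrapT => nX; move: l_sum; apply/negP; rewrite -leqNgt.
have -> : \sum_c l c = \sum_x \sum_c (X x c : nat).
  rewrite exchange_big; apply: eq_bigr => c _.
  by rewrite -lX -sum1_card big_mkcond.
rewrite -sum1_card; apply: leq_sum => x _.
have -> : \sum_c (X x c : nat) = #|[pred c | X x c]|.
  by rewrite -sum1_card [RHS]big_mkcond.
apply/card_le1_eqP => c d /= Xc Xd; apply/eqP/negP => /negP cd.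
by apply: nX; exists x, d, c; split=> //; rewrite eq_sym.
Qed.

(** Three colours are available and each has at least one token. *)
Lemma config_third X : config X -> third_colour X.
Proof.
move=> [_ lX] a b.
have : 0 < #|predC (pred2 a b)|.
  have := cardC (pred2 a b); rewrite card2; move: C_ge3.
  by case: #|predC _| => // + E; rewrite -E addn0; case: (a != b).
case/card_gt0P => k; rewrite !inE => /norP[ka kb].
have : 0 < #|[pred x | X x k]| by rewrite lX.
by case/card_gt0P => x Xk; exists k, x.
Qed.

(** Induction along a path: the interchange of the remaining pair [v1], [w] is conjugated by the one
    along the first edge. *)
Lemma reach_swap v w X : config X -> reach e X (swap_at v w X).
Proof.
have /connectP[p] := e_conn v w; elim: p v X => [|v1 p IH] v X /=.
  by move=> _ -> _; rewrite swapxx; exact: reach_refl.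
move=> /andP[vv1 pv1] wE hX.
have E Z : config Z -> reach e Z (swap_at v v1 Z).
  move=> hZ; apply: reach_swap_edge => //; first exact: (proj1 hZ).
    exact: config_third.
  exact: config_crowded.
have [<-|wv] := eqVneq w v; first by rewrite swapxx; exact: reach_refl.
have [->|wv1] := eqVneq w v1; first exact: E.
have h1 := reach_config hX (E _ hX).
have h2 := reach_config h1 (IH _ _ pv1 wE h1).
have -> : swap_at v w X = swap_at v v1 (swap_at v1 w (swap_at v v1 X)).
  apply: funext => x; rewrite /swap_at (transpC v1 w) transp_conj //.
  by rewrite transpC.
apply: reach_trans (E _ hX) (reach_trans _ (E _ h2)).
exact: IH.
Qed.

(** Interchange [w] with a neighbour [w'] of [v], exchange the colour along that edge, and
    interchange back. *)
Lemma reach_exchange_any i v w X : config X -> covering (exchange (pred1 i) v w X) ->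
  reach e X (exchange (pred1 i) v w X).
Proof.
move=> hX cX'; have [<-|vw] := eqVneq v w.
  suff -> : exchange (pred1 i) v v X = X by exact: reach_refl.
  by apply: funext => x; apply: funext => c; rewrite /exchange transpxx if_same.
(* The neighbour is where a path from [w] first reaches [v]: [exit_path] with both forbidden
   vertices equal to [v]. *)
have [w' [w'N vw']] : exists w', w' != v /\ e v w'.
  have wN : w \notin [:: v; v] by rewrite !inE orbb eq_sym.
  have [y [t [_ yN]]] := exit_path (e_conn w v) wN.
  rewrite !inE orbb => /eqP -> yv; exists y; rewrite e_sym; split=> //.
  by move: yN; rewrite !inE orbb.
have E : exchange (pred1 i) v w X =
    swap_at w w' (exchange (pred1 i) v w' (swap_at w w' X)).
  apply: funext => x; apply: funext => c; rewrite /swap_at /exchange.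
  by case: ifP; rewrite ?transpK // transp_conj // eq_sym.
have R1 := reach_swap w w' hX; have h1 := reach_config hX R1.
have R2 : reach e (swap_at w w' X) (exchange (pred1 i) v w' (swap_at w w' X)).
  apply: reach1 => //; rewrite -[exchange _ _ _ _](@swapK w w') -E.
  exact: covering_swap.
rewrite E; apply: reach_trans R1 (reach_trans R2 _).
by apply: reach_swap; exact: reach_config R2.
Qed.

(** * Decreasing the number of misplaced tokens *)

Lemma covering_exchange_crowded i v w X : covering X -> crowded X v -> X v i ->
  ~~ X w i -> covering (exchange (pred1 i) v w X).
Proof.
move=> cX Xv Xvi Xwi x.
have [->|xv] := eqVneq x v.
  have [d di Xd] := crowded_neq i Xv.
  by exists d; rewrite /exchange /= (negPf di).
have [->|xw] := eqVneq x w; first by exists i; rewrite /exchange /= eqxx transpR.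
have [c Xc] := cX x; exists c; rewrite /exchange /=.
by case: ifP => //; rewrite transpD.
Qed.

(** Both placements put [c] on [l c] vertices, so the vertices of [c] in [Y] cannot form a proper
    subset of those in [X]. *)
Lemma config_misplaced X Y v c : config X -> config Y -> X v c -> ~~ Y v c ->
  exists w, Y w c && ~~ X w c.
Proof.
move=> [_ lX] [_ lY] Xv Yv; apply/existsP; apply: contraT => /existsPn no.
have YX : [pred x | Y x c] \subset [pred x | X x c].
  by apply/fintype.subsetP => x; rewrite !inE => Yx; have := no x; rewrite Yx /= negbK.
have : #|[pred x | X x c]| <= #|[pred x | Y x c]| by rewrite lX lY.
rewrite (geq_leqif (subset_leqif_card YX)) => /fintype.subsetP/(_ v Xv).
by rewrite inE (negPf Yv).
Qed.

Definition misplaced X Y := [pred p : V * C | X p.1 p.2 && ~~ Y p.1 p.2].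

Lemma misplaced_exchange_l v w c X Y : X v c -> ~~ Y v c -> Y w c -> ~~ X w c ->
  #|misplaced (exchange (pred1 c) v w X) Y| < #|misplaced X Y|.
Proof.
move=> Xv Yv Yw Xw; apply: proper_card; apply/properP; split; last first.
  by exists (v, c); rewrite inE /= ?Xv // /exchange /= eqxx transpL (negPf Xw).
apply/fintype.subsetP => -[x d]; rewrite !inE /exchange /=; case: (eqVneq d c) => // ->.
case/andP; have [->|xv] := eqVneq x v; first by rewrite transpL (negPf Xw).
by have [->|xw] := eqVneq x w; [rewrite Yw|rewrite transpD // => -> ->].
Qed.

Lemma misplaced_exchange_r v w c X Y : X v c -> ~~ Y v c -> Y w c -> ~~ X w c ->
  #|misplaced X (exchange (pred1 c) w v Y)| < #|misplaced X Y|.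
Proof.
move=> Xv Yv Yw Xw; apply: proper_card; apply/properP; split; last first.
  by exists (v, c); rewrite inE /= Xv // /exchange /= eqxx transpR Yw.
apply/fintype.subsetP => -[x d]; rewrite !inE /exchange /=; case: (eqVneq d c) => // ->.
case/andP; have [->|xv] := eqVneq x v; first by rewrite Xv.
by have [->|xw] := eqVneq x w; [rewrite (negPf Xw)|rewrite transpD // => -> ->].
Qed.

(** The pairs [(v, c)] and [(w, d)] stop being misplaced, and only [(w, c)] can become so. *)
Lemma misplaced_swap v w c d X Y : c != d -> X v =1 pred1 c -> Y v =1 pred1 d ->
  X w =1 pred1 d -> ~~ Y w d -> #|misplaced (swap_at v w X) Y| < #|misplaced X Y|.
Proof.
move=> cd Xv Yv Xw Yw.
have vw : w != v by apply: contraNneq Yw => ->; rewrite Yv /=.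
have Ov : (v, c) \in misplaced X Y by rewrite inE /= Xv Yv /= eqxx cd.
have Ow : (w, d) \in [predD1 misplaced X Y & (v, c)].
  by rewrite !inE /= xpair_eqE (negPf vw) Xw /= eqxx.
rewrite (cardD1 (v, c) (misplaced X Y)) Ov.
rewrite (cardD1 (w, d) [predD1 misplaced X Y & _]) Ow !add1n ltnS.
set O := [predD1 _ & _]; apply: (@leq_trans #|[predU1 (w, c) & O]|); last first.
  by rewrite cardU1; case: (_ \notin _).
apply/subset_leq_card/fintype.subsetP => -[x i].
rewrite !inE /= !xpair_eqE /swap_at => /andP[].
have [->|xv] := eqVneq x v; first by rewrite transpL Xw Yv /= => ->.
have [->|xw] := eqVneq x w; last by rewrite transpD //= => -> ->.
by rewrite transpR Xv /= => ->.
Qed.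

(** Induction on the number of misplaced tokens. One on a crowded vertex is moved to a vertex
    wanting it, in [X] or symmetrically in [Y]; if there is none, two vertices with single colours
    are interchanged. *)
Lemma reach_all X Y : config X -> config Y -> reach e X Y.
Proof.
have [n] := ubnP #|misplaced X Y|; elim: n X Y => // n IH X Y; rewrite ltnS.
move=> mn hX hY; have [cX _] := hX; have [cY _] := hY.
have [XY|/forallPn[[v c]]] := boolP [forall p, ~~ misplaced X Y p].
  have {}XY v c : X v c -> Y v c.
    by move=> Xv; have /forallP/(_ (v, c)) := XY; rewrite /= Xv /= negbK.
  suff -> : X = Y by exact: reach_refl.
  apply: funext => v; apply: funext => c; apply/idP/idP; first exact: XY.
  move=> Yv; apply: contraT => Xv.
  have [w /andP[Xw]] := config_misplaced hY hX Yv Xv.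
  by rewrite XY.
rewrite negbK => /andP[/= Xv Yv].
have [[t [i [Xt Yt Xti]]]|nX] :=
    pselect (exists t i, [/\ X t i, ~~ Y t i & crowded X t]).
  have [w /andP[Yw Xw]] := config_misplaced hX hY Xt Yt.
  have R : reach e X (exchange (pred1 i) t w X).
    by apply: reach_exchange_any => //; exact: covering_exchange_crowded.
  apply: (reach_trans R); apply: IH => //; last exact: reach_config R.
  exact: leq_trans (misplaced_exchange_l Xt Yt Yw Xw) mn.
have [[t [i [Yt Xt Yti]]]|nY] :=
    pselect (exists t i, [/\ Y t i, ~~ X t i & crowded Y t]).
  have [w /andP[Xw Yw]] := config_misplaced hY hX Yt Xt.
  have R : reach e Y (exchange (pred1 i) t w Y).
    by apply: reach_exchange_any => //; exact: covering_exchange_crowded.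
  apply: (@reach_trans _ _ (exchange (pred1 i) t w Y)); last exact: reach_sym.
  apply: IH => //; last exact: reach_config R.
  exact: leq_trans (misplaced_exchange_r Xw Yw Yt Xt) mn.
(* Every mismatch now sits on an uncrowded vertex. So [v] carries only [c] in [X] and only [d] in
   [Y], and some [w] carries only [d] in [X] but lacks it in [Y]. *)
have Xv1 : X v =1 pred1 c.
  by apply: not_crowded => // Xc; apply: nX; exists v, c.
have [d Yvd] := cY v.
have cd : c != d by apply: contraNneq Yv => ->.
have Xvd : ~~ X v d by rewrite Xv1 /= eq_sym.
have Yv1 : Y v =1 pred1 d.
  by apply: not_crowded => // Yc; apply: nY; exists v, d.
have [w /andP[Xw Yw]] := config_misplaced hY hX Yvd Xvd.
have Xw1 : X w =1 pred1 d.
  by apply: not_crowded => // Xc; apply: nX; exists w, d.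
have R := reach_swap v w hX.
apply: (reach_trans R); apply: IH => //; last exact: reach_config R.
exact: leq_trans (misplaced_swap cd Xv1 Yv1 Xw1 Yw) mn.
Qed.
End Connected.

(** * Existence of a placement *)

Lemma subset_of_card (K : pred V) k : k <= #|V| ->
  exists2 D : pred V, #|D| = k &
    (forall x, D x -> ~~ K x) \/ (forall x, K x || D x).
Proof.
(* Listing the complement of [K] first makes an initial segment of length [k] either miss [K] or
   exhaust the complement. *)
move=> kV; pose s := enum (predC K) ++ enum K.
have us : uniq s.
  rewrite cat_uniq !enum_uniq /= andbT; apply/hasPn => x.
  by rewrite !mem_enum !inE /= => Kx; rewrite negbK.
have ss : size s = #|V| by rewrite size_cat -!cardE addnC cardC.
exists (mem (take k s)).
  by rewrite (card_uniqP _) ?take_uniq // size_takel // ss.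
have [kK|Kk] := leqP k #|predC K|.
  left=> x /=; rewrite takel_cat -?cardE // => /mem_take.
  by rewrite mem_enum.
right=> x /=; rewrite take_cat -cardE ltnNge ltnW //= mem_cat mem_enum inE /=.
by case: (K x).
Qed.

(** Greedy filling: colours are placed one after another, on empty vertices first. The invariant is
    that all vertices are covered, or at least as many are covered as tokens have been placed; in
    the end the latter contradicts [l_sum]. *)
Lemma config_exists (l : C -> nat) : #|V| < \sum_c l c ->
  (forall c, l c <= #|V|) -> exists X, config l X.
Proof.
move=> l_sum lV.
suff [X [lX _ [cX|]]] : exists X,
    [/\ forall c, c \in enum C -> #|[pred x | X x c]| = l c,
        forall c, c \notin enum C -> forall x, ~~ X x c &
        covering X \/
        \sum_(c <- enum C) l c <= #|[pred x | [exists c, X x c]]|].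
- by exists X; split=> // c; apply: lX; rewrite mem_enum.
- rewrite big_enum /= leqNgt => /negP[]; apply: leq_ltn_trans l_sum.
  exact: max_card.
elim: (enum C) (enum_uniq C) => [_|c s IH /= /andP[cs us]].
  by exists (fun _ _ => false); split=> //; right; rewrite big_nil.
have [X [lX nX cX]] := IH us.
have [D lD cD] := subset_of_card [pred x | [exists c, X x c]] (lV c).
pose Y x d := if d == c then D x else X x d.
have XY x d : X x d -> Y x d.
  rewrite /Y; case: eqVneq => // -> Xc.
  by have := nX _ cs x; rewrite Xc.
exists Y; split.
- move=> d; rewrite inE /Y; case: eqVneq => [->|_ /=]; last exact: lX.
  by rewrite -lD.
- move=> d; rewrite inE negb_or => /andP[/negPf dc ds] x.
  by rewrite /Y dc nX.
- have [{}cX|{}cX] := cX.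
    by left=> x; have [d /XY Yd] := cX x; exists d.
  have [DX|DX] := cD; last first.
    left=> x; case/orP: (DX x) => [/existsP[d /XY]|Dx]; first by exists d.
    by exists c; rewrite /Y eqxx.
  right; rewrite big_cons -lD addnC; apply: leq_trans (leq_add cX (leqnn _)) _.
  rewrite -cardUI (eq_card0 (A := predI _ _)) ?addn0 => [|x].
    apply/subset_leq_card/fintype.subsetP => x; rewrite !inE.
    case/orP => [/existsP[d /XY Yd]|Dx]; apply/existsP; first by exists d.
    by exists c; rewrite /Y eqxx.
  by rewrite !inE andbC; case Dx : (x \in D) => //=; exact/negbTE/DX.
Qed.
End Colouring.

Local Open Scope classical_set_scope.

(** * The topological space of a graph *)

Section GraphSpace.
Local Open Scope ring_scope.
Local Open Scope quotient_scope.
Variables (R : realType) (G : fin_graph).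
Local Notation I01 := (`[0, 1]%classic : set R).
Local Notation vpt := (vertex_pt R).

Lemma graph_space_eqP (x y : cells R G) :
  \pi_(graph_space R G) x = \pi_(graph_space R G) y <-> attach x = attach y.
Proof.
split=> [/eqmodP/eqP //|xy]; apply/eqmodP; apply/eqP; exact: xy.
Qed.

Lemma edge_ptE (e : edge G) (t : I01) : edge_pt e t =
  if val t == 0 then vpt (src e) else
  if val t == 1 then vpt (tgt e) else edge_pt e t.
Proof.
case: eqVneq => t0; [|case: eqVneq => t1 //].
  by apply/graph_space_eqP; rewrite /= t0 eqxx.
by apply/graph_space_eqP; rewrite /= t1 oner_eq0 eqxx.
Qed.

Lemma vertex_pt_inj : injective (@vertex_pt R G).
Proof. by move=> v w /graph_space_eqP[]. Qed.

Lemma itv01P (t : I01) : 0 <= val t <= 1.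
Proof. by have := set_valP t; rewrite /= in_itv. Qed.

Lemma edge_interiorP (e : edge G) (t : I01) :
  0 < val t < 1 -> edge_interior e (edge_pt e t).
Proof. by move=> t01; exists t. Qed.

Lemma vertex_not_interior (e : edge G) v : ~ edge_interior e (vpt v).
Proof.
move=> [t /= /andP[t0 t1]] /graph_space_eqP /=.
by rewrite gt_eqF // lt_eqF.
Qed.

Lemma edge_interior_inj (e f : edge G) (p : graph_space R G) :
  edge_interior e p -> edge_interior f p -> e = f.
Proof.
move=> [t /= /andP[t0 t1] <-] [s /= /andP[s0 s1]] /graph_space_eqP /=.
by rewrite (gt_eqF t0) (lt_eqF t1) (gt_eqF s0) (lt_eqF s1) => -[->].
Qed.

Lemma edge_pt_case (e : edge G) (t : I01) :
  [\/ edge_pt e t = vpt (src e), edge_pt e t = vpt (tgt e) |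
      edge_interior e (edge_pt e t)].
Proof.
have /andP[t0 t1] := itv01P t; rewrite edge_ptE; case: eqVneq => n0; first exact: Or31.
case: eqVneq => n1; first exact: Or32.
by apply/Or33/edge_interiorP; rewrite !lt_neqAle eq_sym n0 n1 t0.
Qed.

Lemma graph_space_case (p : graph_space R G) :
  (exists v, p = vpt v) \/ exists e, edge_interior e p.
Proof.
rewrite -[p]reprK; case: (repr p) => -[v|e] t.
  by left; exists v; apply/graph_space_eqP.
have [] := edge_pt_case e t; rewrite /edge_pt /edge_cell => E.
- by left; exists (src e).
- by left; exists (tgt e).
- by right; exists e.
Qed.

Definition linked : rel (vertex G) := fun v w =>
  [exists e : edge G, ((src e == v) && (tgt e == w)) ||
                      ((src e == w) && (tgt e == v))].

Lemma linked_sym : symmetric linked.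
Proof. by move=> v w; apply: eq_existsb => e; rewrite orbC. Qed.

Lemma edge_pt_continuous (e : edge G) :
  continuous (@edge_pt R G e).
Proof.
move=> t; apply: (@continuous_comp _ _ _ (@edge_cell R G e) (\pi_(graph_space R G))).
  exact: existT_continuous.
exact: pi_continuous.
Qed.

(** Membership in the combinatorial component of [x] is constant on each closed cell, so it cuts out
    a clopen set. *)
Lemma graph_connected : connected [set: graph_space R G] ->
  forall x y, connect linked x y.
Proof.
move=> cG x y.
pose side (a : vertex G + edge G * R) :=
  connect linked x (match a with inl v => v | inr (e, _) => src e end).
(* An interior point is assigned to the source of its edge; the target would give the same
   answer. *)
have st (e : edge G) : connect linked x (src e) = connect linked x (tgt e).
  apply: same_connect_r; first exact: sym_connect_sym linked_sym.
  by apply: connect1; apply/existsP; exists e; rewrite !eqxx.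
have sideE (z : cells R G) : side (attach (repr (\pi_(graph_space R G) z))) = side (attach z).
  by congr side; apply/graph_space_eqP; rewrite reprK.
have side_edge e t : side (attach (edge_cell e t)) = connect linked x (src e).
  by rewrite /side /=; case: eqP => // _; case: eqP.
(* Openness in the quotient is tested on the preimage, cell by cell, where it is everything or
   empty. *)
have side_open b : open [set p : graph_space R G | side (attach (repr p)) = b].
  suff : open (\pi_(graph_space R G) @^-1`
    [set p : graph_space R G | side (attach (repr p)) = b]) by [].
  apply/sigT_openP => -[v|e].
    have [vb|vb] := eqVneq (connect linked x v) b.
      rewrite (_ : _ @^-1` _ = setT); first exact: openT.
      by apply/seteqP; split=> // t _ /=; rewrite sideE.
    rewrite (_ : _ @^-1` _ = set0); first exact: open0.
    by apply/seteqP; split=> // t /=; rewrite sideE /side /= => /eqP; rewrite (negPf vb).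
  have [vb|vb] := eqVneq (connect linked x (src e)) b.
    rewrite (_ : _ @^-1` _ = setT); first exact: openT.
    by apply/seteqP; split=> // t _ /=; rewrite sideE side_edge.
  rewrite (_ : _ @^-1` _ = set0); first exact: open0.
  by apply/seteqP; split=> // t /=; rewrite sideE side_edge => /eqP; rewrite (negPf vb).
pose B := [set p : graph_space R G | side (attach (repr p)) = true].
have BT : B = setT.
  apply: cG.
  - by exists (vpt x); rewrite /B /= sideE /side /= connect0.
  - by exists B; [exact: side_open|rewrite setTI].
  - exists B; last by rewrite setTI.
    rewrite -openC (_ : ~` B = [set p | side (attach (repr p)) = false]) //.
    by apply/seteqP; split=> p /=; rewrite /B /=; case: (side _).
have : B (vpt y) by rewrite BT.
by rewrite /B /= sideE.
Qed.
End GraphSpace.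

(** * Paths in configuration spaces *)

Lemma pointsK (X : topologicalType) l (A B : subset_conf X l) :
  points A = points B -> A = B.
Proof. exact: val_inj. Qed.

(** The motion is lifted to ordered tuples: in an enumeration of [A], the coordinate equal to [p0]
    is replaced by [p z]. Avoiding the other points keeps the tuple injective. *)
Lemma subset_conf_path (X Z : topologicalType) l (A : subset_conf X l) (p0 : X)
    (p : Z -> X) : continuous p -> points A p0 ->
  (forall z, ~ (points A `\ p0) (p z)) ->
  exists F : Z -> subset_conf X l, continuous F /\
    forall z, points (F z) = (points A `\ p0) `|` [set p z].
Proof.
move=> cp Ap0 pA.
have /set_mem /= hI := valP (conf_enum A).
set h := val (conf_enum A) in hI.
have hA : points A = range (h : 'I_l -> X).
  by rewrite -[in LHS](conf_enumK A).
have [m _ hm] : range (h : 'I_l -> X) p0 by rewrite -hA.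
have hAm k : k != m -> (points A `\ p0) (h k).
  by move=> km; split; [rewrite hA; exists k|move=> /=; rewrite -hm => /hI/eqP; rewrite (negPf km)].
have inj z : (dfwith h m (p z) : {ptws 'I_l -> X}) \in [set f : {ptws 'I_l -> X} | injective f].
  rewrite inE /= => i j.
  have [->|im] := eqVneq i m; have [->|jm] := eqVneq j m => //.
  - rewrite dfwithin dfwithout 1?eq_sym // => E.
    by case: (pA z); rewrite E; exact: hAm.
  - rewrite dfwithin dfwithout 1?eq_sym // => E.
    by case: (pA z); rewrite -E; exact: hAm.
  - by rewrite !dfwithout 1?eq_sym //; exact: hI.
pose g z : ordered_conf X l := SigSub (inj z).
exists (fun z => conf_range (g z)); split.
  move=> z; apply: (@continuous_comp _ _ _ g (@conf_range X l)); last first.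
    have -> : @conf_range X l = (\pi_(subset_conf X l))%qT by rewrite pi.unlock.
    exact: pi_continuous.
  apply: (@continuous_comp_initial _ _ _ val g).
  move=> z'.
  have H := @dfwith_continuous 'I_l (fun=>X) h m (p z').
  have H2 : {for p z', continuous (dfwith h m : X -> {ptws 'I_l -> X})} by exact: H.
  exact: (@continuous_comp Z X ({ptws 'I_l -> X}) p (dfwith h m) z' (cp z') H2).
move=> z; rewrite /points /=; apply/seteqP; split=> x /=.
  move=> [k _ <-]; have [->|km] := eqVneq k m; first by right; rewrite dfwithin.
  by left; rewrite dfwithout 1?eq_sym //; exact: hAm.
move=> [[]|->]; last by exists m => //; rewrite dfwithin.
rewrite -/(points A x) hA => -[k _ <-] xp; exists k => //; rewrite dfwithout //.
by rewrite eq_sym; apply: contra_not_neq xp => ->.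
Qed.

(** * Concatenation of paths *)

Section Paths.
Local Open Scope ring_scope.
Variables (R : realType) (T : topologicalType).

(** Paths live on the whole line and stay in [S] at all times, so plain continuity suffices and
    values lift to the subspace. *)
Definition joined_in (S : set T) (x y : T) := exists f : R -> T,
  [/\ continuous f, forall t, S (f t), f 0 = x & f 1 = y].

Lemma joined_in_sym S x y : joined_in S x y -> joined_in S y x.
Proof.
move=> [f [cf fS f0 f1]]; exists (fun t => f (1 - t)); split=> //.
- move=> t; apply: (@continuous_comp _ _ _ (fun t : R => 1 - t) f); last exact: cf.
  by apply: cvgB; [exact: cvg_cst|exact: cvg_id].
- by rewrite subr0.
- by rewrite subrr.
Qed.

Lemma joined_in_trans S x y z :
  joined_in S x y -> joined_in S y z -> joined_in S x z.
Proof.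
move=> [f [cf fS f0 f1]] [g [cg gS g0 g1]].
pose h (t : R) := if t <= 2^-1 then f (2 * t) else g (2 * t - 1).
have cf2 : continuous (fun t : R => f (2 * t)).
  move=> t; apply: (@continuous_comp _ _ _ (fun t : R => 2 * t) f); last exact: cf.
  by apply: cvgM; [exact: cvg_cst|exact: cvg_id].
have cg2 : continuous (fun t : R => g (2 * t - 1)).
  move=> t; apply: (@continuous_comp _ _ _ (fun t : R => 2 * t - 1) g); last exact: cg.
  by apply: cvgB; [apply: cvgM; [exact: cvg_cst|exact: cvg_id]|exact: cvg_cst].
exists h; split.
- apply/continuous_subspace_setT.
  (* Pasting along two closed half-lines, where both pieces agree at [2^-1]. *)
  have -> : [set: R] = [set t | t <= 2^-1] `|` [set t | 2^-1 <= t].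
    by apply/seteqP; split=> // t _ /=; case: (leP t 2^-1) => [|/ltW]; [left|right].
  apply: withinU_continuous; [exact: closed_le|exact: closed_ge| |].
    apply: (@subspace_eq_continuous _ _ _ (fun t : R => f (2 * t))).
      by move=> t; rewrite inE /= => ht; rewrite /from_subspace /h ht.
    exact: continuous_subspaceT.
  apply: (@subspace_eq_continuous _ _ _ (fun t : R => g (2 * t - 1))).
    move=> t; rewrite inE /= /from_subspace /h le_eqVlt => /orP[/eqP<-|ht].
      by rewrite lexx divff // subrr f1 g0.
    by rewrite leNgt ht.
  exact: continuous_subspaceT.
- by move=> t; rewrite /h; case: ifP.
- by rewrite /h invr_ge0 ler0n mulr0.
- by rewrite /h ifN ?mulr1 -?ltNge ?invf_lt1 ?ltr1n // (_ : 2 - 1 = 1) //; ring.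
Qed.

Lemma joined_in_refl (S : set T) x : S x -> joined_in S x x.
Proof. by move=> Sx; exists (fun=> x); split=> // t; exact: cvg_cst. Qed.

Lemma joined_in_path_connected (S : set T) : S !=set0 ->
  (forall x y, S x -> S y -> joined_in S x y) -> path_connected R S.
Proof.
move=> [x0 Sx0] SS; split; first by constructor; exists x0; exact: mem_set.
move=> x y; have [f [cf fS f0 f1]] := SS _ _ (set_valP x) (set_valP y).
exists (fun t => SigSub (mem_set (fS t)) : S); split.
- apply: continuous_subspaceT.
  exact: (@continuous_comp_initial _ _ _ val).
- exact: val_inj.
- exact: val_inj.
Qed.
End Paths.

(** * Straight segments in the unit interval *)

Section Segment.
Local Open Scope ring_scope.
Variable R : realType.
Local Notation I01 := (`[0, 1]%classic : set R).

(** Makes segments constant outside the unit interval, since paths are parametrized by all of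
    [R]. *)
Definition clamp (s : R) : R := Num.max 0 (Num.min 1 s).

Lemma clamp_itv s : 0 <= clamp s <= 1.
Proof. by rewrite /clamp le_max lexx ge_max ler01 ge_min lexx. Qed.

Lemma clamp_continuous : continuous clamp.
Proof.
move=> s; apply: (@continuous_max R R (fun=> 0) (fun s => Num.min 1 s)).
  exact: cvg_cst.
apply: (@continuous_min R R (fun=> 1) id); [exact: cvg_cst|exact: cvg_id].
Qed.

Lemma segment_subproof (t0 t1 : I01) s :
  (1 - clamp s) * val t0 + clamp s * val t1 \in `[0, 1]%classic.
Proof.
rewrite inE /= in_itv /=; have /andP[c0 c1] := clamp_itv s.
have := set_valP t0; have := set_valP t1.
by rewrite /= !in_itv /= => /andP[? ?] /andP[? ?]; apply/andP; split; nra.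
Qed.

Definition segment (t0 t1 : I01) s : I01 := SigSub (segment_subproof t0 t1 s).

Lemma segment0 t0 t1 : segment t0 t1 0 = t0.
Proof.
apply: val_inj => /=; rewrite /clamp /Num.min ltr10.
by rewrite maxxx subr0 mul1r mul0r addr0.
Qed.

Lemma segment1 t0 t1 : segment t0 t1 1 = t1.
Proof.
apply: val_inj => /=; rewrite /clamp minxx max_r ?ler01 //.
by rewrite subrr mul0r mul1r add0r.
Qed.

Lemma segment_continuous t0 t1 : continuous (segment t0 t1).
Proof.
apply: (@continuous_comp_initial _ _ _ val) => s /=.
apply: (@cvgD _ R^o); apply: cvgM; try exact: cvg_cst; last exact: clamp_continuous.
by apply: cvgB; [exact: cvg_cst|exact: clamp_continuous].
Qed.
End Segment.

(** * Sliding a point along an edge *)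

Section Slides.
Local Open Scope ring_scope.
Variables (R : realType) (G : fin_graph) (r : nat) (l : 'I_r -> nat).
Local Notation I01 := (`[0, 1]%classic : set R).
Local Notation vpt := (@vertex_pt R G).
Local Notation conf := (configuration R G l).
Local Notation S := (@stirling_complex R G r l).
Implicit Types (A B : conf).

Lemma configuration_path A i (p0 : graph_space R G) (p : R -> graph_space R G) :
  continuous p -> points (A i) p0 ->
  (forall s, ~ (points (A i) `\ p0) (p s)) ->
  exists F : R -> conf, [/\ continuous F,
    forall s j, j != i -> F s j = A j &
    forall s, points (F s i) = (points (A i) `\ p0) `|` [set p s]].
Proof.
move=> cp Ap0 pA; have [F [cF FE]] := subset_conf_path cp Ap0 pA.
exists (fun s => dfwith (A : forall j, subset_conf (graph_space R G) (l j)) i (F s)).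
split.
- move=> s.
  have dF : {for F s, continuous
      (dfwith (A : forall j, subset_conf (graph_space R G) (l j)) i : _ -> conf)}.
    exact: (@dfwith_continuous 'I_r (fun j => subset_conf (graph_space R G) (l j))).
  exact: (@continuous_comp R _ conf F _ s (cF s) dF).
- by move=> s j ji; rewrite dfwithout // eq_sym.
- by move=> s; rewrite dfwithin FE.
Qed.

Lemma configuration_ext A B : (forall i, points (A i) = points (B i)) -> A = B.
Proof.
by move=> AB; apply: functional_extensionality_dep => i; apply: pointsK.
Qed.

(** No vertex is uncovered, as the moving point starts inside [e]. Its colour is absent from the
    ends of [e] and from the interiors of the edges touching [e], so any position on the closed edge
    is legal. *)
Lemma stirling_slide A B i (e : edge G) (t0 t : I01) : S A -> 0 < val t0 < 1 ->
  points (A i) (edge_pt e t0) -> (forall j, j != i -> B j = A j) ->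
  points (B i) = (points (A i) `\ edge_pt e t0) `|` [set edge_pt e t] -> S B.
Proof.
move=> [covA intA] t01 Ap0 BA Bi.
have p0e : edge_interior e (edge_pt e t0) by exact: edge_interiorP.
have [Asrc Atgt Ae] := intA _ _ _ Ap0 p0e.
have see : share_endpoint e e by exists (src e); split; left.
split.
  move=> v; have [j Aj] := covA v; exists j.
  have [ji|ji] := eqVneq j i; last by rewrite BA.
  rewrite ji Bi; left; split; first by rewrite -ji.
  by move=> /= E; apply: (@vertex_not_interior R G e v); rewrite E.
move=> j f q; have [->{j}|ji] := eqVneq j i; last by rewrite BA //; exact: intA.
set D := points (A i) `\ _ in Bi; set p := edge_pt e t in Bi.
(* The other interior points of colour [i] lie on edges disjoint from [e]. *)
have far f' q' : D q' -> edge_interior f' q' -> ~ share_endpoint e f'.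
  by move=> [Aq' q'p] q'f' ef'; apply: q'p; exact: Ae ef' Aq' q'f'.
have p_interior f' : edge_interior f' p -> f' = e.
  rewrite /p; have [->|->|pe pf'] := edge_pt_case e t; last exact: edge_interior_inj pf' pe.
    by move=> /vertex_not_interior.
  by move=> /vertex_not_interior.
have p_vertex v : p = vpt v -> v = src e \/ v = tgt e.
  move=> pv; have := edge_pt_case e t; rewrite -/p pv => -[].
  - by move=> /vertex_pt_inj ->; left.
  - by move=> /vertex_pt_inj ->; right.
  - by move=> /vertex_not_interior.
rewrite Bi => -[Dq qf|-> pf].
  have nef := far _ _ Dq qf; have [Aq _] := Dq.
  have [nsrc ntgt uq] := intA _ _ _ Aq qf.
  split.
  - move=> [[//]|/esym/p_vertex E]; apply: nef; exists (src f).
    by split=> //; left.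
  - move=> [[//]|/esym/p_vertex E]; apply: nef; exists (tgt f).
    by split=> //; right.
  - move=> f' q' ff' [[Aq' _]|->]; first exact: uq.
    by move=> /p_interior f'e; case: nef; rewrite -f'e; case: ff' => v [? ?]; exists v.
have fe := p_interior _ pf; rewrite fe in pf *.
split.
- by move=> [[//]|E]; apply: (@vertex_not_interior R G e (src e)); rewrite E.
- by move=> [[//]|E]; apply: (@vertex_not_interior R G e (tgt e)); rewrite E.
- by move=> f' q' ef' [Dq'|-> //] q'f'; case: (far _ _ Dq' q'f').
Qed.

(** The moving point meets no other point of its colour, as the closed edge contains none. *)
Lemma joined_slide A i (e : edge G) (t0 t1 : I01) : S A -> 0 < val t0 < 1 ->
  points (A i) (edge_pt e t0) ->
  exists B, [/\ joined_in R S A B, S B, forall j, j != i -> B j = A j &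
    points (B i) = (points (A i) `\ edge_pt e t0) `|` [set edge_pt e t1]].
Proof.
move=> SA t01 Ap0; have [_ intA] := SA.
have [Asrc Atgt Ae] := intA _ _ _ Ap0 (edge_interiorP e t01).
have free t : ~ (points (A i) `\ edge_pt e t0) (edge_pt e t).
  have [->|->|pe] := edge_pt_case e t; [by case|by case|move=> [Ap]].
  by apply; apply: Ae Ap pe; exists (src e); split; left.
have cp : continuous (fun s => edge_pt e (segment t0 t1 s)).
  move=> s; apply: (@continuous_comp _ _ _ (segment t0 t1) (@edge_pt R G e)).
    exact: segment_continuous.
  exact: edge_pt_continuous.
have [F [cF Fj Fi]] := configuration_path cp Ap0 (fun s => free _).
have SF s : S (F s) := stirling_slide SA t01 Ap0 (Fj s) (Fi s).
exists (F 1); split=> //; last by rewrite Fi segment1.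
  exists F; split=> //; apply: configuration_ext => j.
  have [->|ji] := eqVneq j i; last by rewrite Fj.
  rewrite Fi segment0; apply/seteqP; split=> [x [[]//|-> //]|x Ax].
  by have [->|xp] := pselect (x = edge_pt e t0); [right|left].
exact: Fj.
Qed.
End Slides.

(** * Configurations supported on the vertices *)

Lemma card_eq_pred (T : finType) (D : pred T) : ([set x | D x] #= `I_#|D|)%card.
Proof.
have -> : [set x | D x] = (@enum_val T D) @` [set: 'I_#|D|].
  apply/seteqP; split=> x /=; last by move=> [i _ <-]; exact: enum_valP.
  by move=> Dx; exists (enum_rank_in Dx x) => //; rewrite enum_rankK_in.
apply: (card_eq_trans (B := [set: 'I_#|D|])).
  by apply: inj_card_eq => i j _ _; exact: enum_val_inj.
by rewrite card_eq_sym; exact: card_II.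
Qed.

Section VertexConfigurations.
Local Open Scope ring_scope.
Local Open Scope card_scope.
Variables (R : realType) (G : fin_graph) (r : nat) (l : 'I_r -> nat).
Local Notation I01 := (`[0, 1]%classic : set R).
Local Notation vpt := (@vertex_pt R G).
Local Notation conf := (configuration R G l).
Local Notation S := (@stirling_complex R G r l).
Implicit Types (A B : conf) (X Y : vertex G -> 'I_r -> bool).

Definition realizes A X := forall i, points (A i) = vpt @` [set v | X v i].

Lemma realizes_vertex A X : realizes A X ->
  forall i v, points (A i) (vpt v) <-> X v i.
Proof.
move=> AX i v; rewrite AX; split; last by exists v.
by move=> [w Xw /vertex_pt_inj <-].
Qed.

Lemma realizes_no_interior A X : realizes A X -> forall i (e : edge G) p,
  points (A i) p -> ~ edge_interior e p.
Proof. by move=> AX i e p; rewrite AX => -[v _ <-]; exact: vertex_not_interior. Qed.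

Lemma realizes_stirling A X : covering X -> realizes A X -> S A.
Proof.
move=> cX AX; split=> [v|i e p Ap pe].
  by have [c Xc] := cX v; exists c; apply/(realizes_vertex AX).
by case: (realizes_no_interior AX Ap pe).
Qed.

Lemma vertex_card (D : pred (vertex G)) : vpt @` [set v | D v] #= `I_#|D|.
Proof.
apply: card_eq_trans (card_eq_pred D).
by apply: inj_card_eq => v w _ _; exact: vertex_pt_inj.
Qed.

Lemma realizes_card A X : realizes A X ->
  forall i, #|[pred v | X v i]| = l i.
Proof.
move=> AX i; have := set_valP (A i); rewrite /= -/(points (A i)) AX => Al.
apply/(@card_eq_II); apply: card_eq_trans Al.
by rewrite card_eq_sym; exact: vertex_card.
Qed.

Lemma realizes_exists X : (forall i, #|[pred v | X v i]| = l i) ->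
  exists A, realizes A X.
Proof.
move=> lX.
have cX i : vpt @` [set v | X v i] \in [set D : set (graph_space R G) | D #= `I_(l i)].
  by rewrite inE /= -lX; exact: (@vertex_card [pred v | X v i]).
by exists (fun i => SigSub (cX i)).
Qed.

Lemma realizes_unique A B X : realizes A X -> realizes B X -> A = B.
Proof. by move=> AX BX; apply: configuration_ext => i; rewrite AX BX. Qed.

Lemma half_subproof : (2^-1 : R) \in `[0, 1]%classic.
Proof. by rewrite inE /= in_itv /=; apply/andP; split; lra. Qed.

Definition half : I01 := SigSub half_subproof.

Lemma half_interior : 0 < val half < 1.
Proof. by rewrite /=; apply/andP; split; lra. Qed.

Lemma itv01_0_subproof : (0 : R) \in `[0, 1]%classic.
Proof. by rewrite inE /= in_itv /= lexx ler01. Qed.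
Lemma itv01_1_subproof : (1 : R) \in `[0, 1]%classic.
Proof. by rewrite inE /= in_itv /= lexx ler01. Qed.

Lemma edge_pt0 (e : edge G) : edge_pt e (SigSub itv01_0_subproof : I01) = vpt (src e).
Proof. by rewrite edge_ptE /= eqxx. Qed.

Lemma edge_pt1 (e : edge G) : edge_pt e (SigSub itv01_1_subproof : I01) = vpt (tgt e).
Proof. by rewrite edge_ptE /= oner_eq0 eqxx. Qed.

Lemma edge_pt_end (e : edge G) v : v = src e \/ v = tgt e ->
  exists t : I01, edge_pt e t = vpt v.
Proof.
by move=> [->|->]; [exists (SigSub itv01_0_subproof); exact: edge_pt0
  |exists (SigSub itv01_1_subproof); exact: edge_pt1].
Qed.

(* Both configurations are slid from the one where the moving point sits in the
   middle of the edge. *)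
Lemma joined_exchange A B X i v w : linked v w -> covering X ->
  covering (exchange (pred1 i) v w X) -> X v i -> ~~ X w i ->
  realizes A X -> realizes B (exchange (pred1 i) v w X) -> joined_in R S A B.
Proof.
move=> /existsP[e vwe] cX cY Xv Xw AX BY; set Y := exchange _ _ _ _ in cY BY.
have vw : v != w by apply: contraNneq Xw => <-.
have [ev ew] : (v = src e \/ v = tgt e) /\ (w = src e \/ w = tgt e).
  by case/orP: vwe => /andP[/eqP <- /eqP <-]; split; by [left|right].
have ends u : u = src e \/ u = tgt e -> u = v \/ u = w.
  by case/orP: vwe => /andP[/eqP <- /eqP <-] []; by [left|right].
have Yi u : Y u i = (u == w) || (u != v) && X u i.
  rewrite /Y /exchange /= eqxx /transp; case: eqVneq => [->|uv].
    by rewrite (negPf Xw) (negPf vw).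
  by case: eqVneq => // ->; rewrite Xv.
have Yj u j : j != i -> Y u j = X u j by rewrite /Y /exchange /= => /negPf ->.
(* A constant path serves only to build [M], in which the midpoint replaces [v] in colour [i]. *)
have cp : continuous (fun _ : R => edge_pt e half) by move=> ?; exact: cvg_cst.
have midNA u : edge_pt e half <> vpt u.
  move=> E; apply: (@vertex_not_interior R G e u); rewrite -E.
  exact: edge_interiorP half_interior.
have Avi : points (A i) (vpt v) by apply/(realizes_vertex AX).
have free (s : R) : ~ (points (A i) `\ vpt v) (edge_pt e half).
  by rewrite AX => -[[u _ /esym/midNA]].
have [F [_ Fj Fi]] := configuration_path cp Avi free.
pose M := F 0; have Mj j : j != i -> M j = A j := Fj 0 j.
have Mi : points (M i) = (points (A i) `\ vpt v) `|` [set edge_pt e half] := Fi 0.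
have Mmid : points (M i) (edge_pt e half) by rewrite Mi; right.
have Mvertex u : points (M i) (vpt u) -> X u i /\ u != v.
  rewrite Mi => -[[/(realizes_vertex AX) Xu uv]|/= /esym/midNA//].
  by split=> //; apply/eqP => E; apply: uv; rewrite E.
have SM : S M.
  split.
    move=> u.
    have [c Xc cN] : exists2 c, X u c & (c != i) || (u != v).
      have [->|uv] := eqVneq u v; last by have [c Xc] := cX u; exists c; rewrite ?orbT.
      (* In [M] the vertex [v] is still covered, by a colour that covers it after the exchange. *)
      have [c Yc] := cY v; have ci : c != i.
        by apply: contraTneq Yc => ->; rewrite Yi (negPf vw) eqxx.
      by exists c; rewrite ?ci // -Yj.
    exists c; have Ac : points (A c) (vpt u) by apply/(realizes_vertex AX).
    have [ci|ci] := eqVneq c i; last by rewrite Mj.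
    rewrite ci in Ac cN *; rewrite Mi; left; split=> //=.
    by move=> /vertex_pt_inj /eqP; rewrite eqxx /= in cN; rewrite (negPf cN).
  move=> j f p; have [->|ji] := eqVneq j i; last first.
    by rewrite Mj // => Ap /(realizes_no_interior AX Ap).
  have intM g q : points (M i) q -> edge_interior g q -> q = edge_pt e half /\ g = e.
    rewrite Mi => -[[Aq _] /(realizes_no_interior AX Aq)//|/= -> gq]; split=> //.
    by apply: edge_interior_inj gq _; apply: edge_interiorP; exact: half_interior.
  move=> Mp pf; have [-> ->] := intM _ _ Mp pf; split.
  - by move=> /Mvertex[Xu uv]; have [E|E] := ends (src e) (or_introl erefl);
      [rewrite E eqxx in uv|rewrite E (negPf Xw) in Xu].
  - by move=> /Mvertex[Xu uv]; have [E|E] := ends (tgt e) (or_intror erefl);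
      [rewrite E eqxx in uv|rewrite E (negPf Xw) in Xu].
  - by move=> g q _ Mq qg; have [] := intM _ _ Mq qg.
have Mrest : points (M i) `\ edge_pt e half = points (A i) `\ vpt v.
  rewrite Mi; apply/seteqP; split=> x /=; first by move=> [[]].
  by move=> Ax; split; [left|move=> E; apply: (free 0); rewrite -E].
have end_at u C : (u = src e \/ u = tgt e) -> (forall j, j != i -> C j = A j) ->
    points (C i) = (points (A i) `\ vpt v) `|` [set vpt u] -> joined_in R S M C.
  move=> eu Cj Ci; have [t tu] := edge_pt_end eu.
  have [C' [MC' _ C'j C'i]] := joined_slide t SM half_interior Mmid.
  suff <- : C' = C by [].
  apply: configuration_ext => j; have [->|ji] := eqVneq j i.
    by rewrite C'i Ci Mrest tu.
  by rewrite C'j // Mj // Cj.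
apply: (@joined_in_trans _ _ _ _ M).
  apply: joined_in_sym; apply: (end_at v) => //.
  apply/seteqP; split=> x /=.
    by move=> Ax; have [->|xv] := pselect (x = vpt v); [right|left].
  by move=> [[]//|->].
apply: (end_at w) => // [j ji|].
  by apply: pointsK; rewrite BY AX; congr image; apply/seteqP; split=> u /=; rewrite Yj.
rewrite BY AX; apply/seteqP; split=> x /=.
  move=> [u]; rewrite Yi => /orP[/eqP-> <-|/andP[uv Xu] <-]; first by right.
  by left; split; [exists u|move=> /vertex_pt_inj /eqP; rewrite (negPf uv)].
move=> [[[u Xu <-] uv]|->]; last by exists w => //; rewrite Yi eqxx.
exists u => //; rewrite Yi Xu andbT; apply/orP; right.
by apply/eqP => E; apply: uv; rewrite E.
Qed.

Lemma joined_reach A B X Y : covering X -> reach (@linked G) X Y ->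
  realizes A X -> realizes B Y -> joined_in R S A B.
Proof.
move=> cX XY AX; elim: XY B => [|Z i v w XZ IH vw cY] B BY.
  rewrite -(realizes_unique AX BY); apply: joined_in_refl.
  exact: realizes_stirling cX AX.
have cZ := reach_covering cX XZ.
have [D DZ] : exists D, realizes D Z.
  apply: realizes_exists => j.
  by rewrite (reach_card _ XZ) (realizes_card AX).
apply: (joined_in_trans (IH _ DZ)).
have [Zvw|Zvw] := eqVneq (Z v i) (Z w i).
  rewrite exchange1_id // in BY; rewrite (realizes_unique DZ BY).
  by apply: joined_in_refl; exact: realizes_stirling cZ BY.
have [Zv|Zv] := boolP (Z v i).
  by apply: (joined_exchange vw cZ cY Zv _ DZ BY); move: Zvw; rewrite Zv; case: (Z w i).
(* The token sits on [w], so the exchange is read as a slide from [w] to [v]. *)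
rewrite exchangeC in cY BY; rewrite linked_sym in vw.
by apply: (joined_exchange vw cZ cY _ Zv DZ BY); move: Zvw; rewrite (negPf Zv); case: (Z w i).
Qed.

Definition interior_pairs A : {set 'I_r * edge G} :=
  [set q | `[< exists2 p, points (A q.1) p & edge_interior q.2 p >]]%SET.

(** Induction on the number of occupied pairs of a colour and an edge interior: an interior point is
    slid to the source of its edge. *)
Lemma joined_vertices A : S A -> exists B X,
  [/\ joined_in R S A B, covering X & realizes B X].
Proof.
have [n] := ubnP #|interior_pairs A|; elim: n A => // n IH A; rewrite ltnS.
move=> An SA; have [covA intA] := SA.
have [A0|[[i e]]] := set_0Vmem (interior_pairs A).
  exists A, (fun v i => `[< points (A i) (vpt v) >]); split.
  - exact: joined_in_refl.
  - by move=> v; have [i Av] := covA v; exists i; apply/asboolP.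
  - move=> i; apply/seteqP; split=> p.
      move=> Ap; have [[v pv]|[e pe]] := graph_space_case p.
        by exists v => //=; apply/asboolP; rewrite -pv.
      suff : (i, e) \in interior_pairs A by rewrite A0 inE.
      by rewrite inE; apply/asboolP; exists p.
    by move=> [v /asboolP Av <-].
rewrite inE => /asboolP[/= p0 Ap0 [t0 t01 E]]; rewrite -{}E in Ap0.
have [t1 t1E] := edge_pt_end (or_introl (erefl (src e))).
have [B [AB SB Bj Bi]] := joined_slide t1 SA t01 Ap0.
have [] := IH B _ SB; last first.
  by move=> C [X [BC cX CX]]; exists C, X; split=> //; exact: joined_in_trans BC.
apply: leq_trans An; apply: proper_card; apply/properP; split.
  apply/fintype.subsetP => -[j f]; rewrite !inE => -[/= q Bq qf].
  exists q => //=; have [ji|ji] := eqVneq j i; last by rewrite -Bj.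
  move: Bq; rewrite ji Bi => -[[]//|/= qE].
  by case: (@vertex_not_interior R G f (src e)); rewrite -t1E -qE.
have pe := edge_interiorP e t01.
exists (i, e); first by rewrite inE; apply/asboolP; exists (edge_pt e t0).
(* The pair [(i, e)] disappears because colour [i] had no second point inside [e]. *)
rewrite inE; apply/asboolP => -[/= q]; rewrite Bi => -[[Aq qp] qe|/= -> ].
  have [_ _ Ae] := intA _ _ _ Ap0 pe.
  by apply: qp; apply: Ae Aq qe; exists (src e); split; left.
by rewrite t1E => /vertex_not_interior.
Qed.
End VertexConfigurations.

Theorem theorem3p10 (R : realType) (G : fin_graph) (r : nat)
    (l : 'I_r -> nat) (connG : connected [set: graph_space R G])
    (l_color : color_vector l) (l_nontriv : nontrivial G l) (r_ge3 : 3 <= r) :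
  path_connected R (stirling_complex R G l).
Proof.
have [l_sum l_lt] := l_nontriv.
apply: joined_in_path_connected => [|A B SA SB].
  have [X [cX lX]] := config_exists l_sum (fun c => ltnW (l_lt c)).
  have [A AX] := realizes_exists R lX; exists A; exact: realizes_stirling cX AX.
have [A' [X [AA' cX AX]]] := joined_vertices SA.
have [B' [Y [BB' cY BY]]] := joined_vertices SB.
apply: joined_in_trans AA' (joined_in_trans _ (joined_in_sym BB')).
apply: (joined_reach cX _ AX BY).
apply: (reach_all (@linked_sym G) (graph_connected connG) l_color l_sum).
- by rewrite card_ord.
- by split=> // c; exact: realizes_card AX c.
- by split=> // c; exact: realizes_card BY c.
Qed.
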